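(* For all integers $t\geq 1$ and $r\geq 3$ there exists a number $f(t,r)$ such that if $G$ is a $(30t-15)$-connected line graph with $|V(G)|\geq f(t,r)$, then $G$ contains $L(C_{t,r})$ as a minor.
   Context: All graphs are finite and loopless but may have parallel edges. For a graph $H$, the line graph $L(H)$ is the simple graph with vertex set $E(H)$ in which two distinct edges of $H$ are adjacent if and only if they share an end. A graph $G$ is a line graph if $G\cong L(H)$ for some (loopless, possibly multi-) graph $H$. A graph $J$ is a minor of $G$ if a graph isomorphic to $J$ can be obtained from a subgraph of $G$ by contracting edges. For integers $t\geq 1$, $r\geq 2$, $C_{t,r}$ denotes the graph obtained from a cycle on $r$ vertices by replacing each edge by $t$ parallel edges. *)

(* Defs.v *)
(* finite simple graphs as symmetric irreflexive relations. *)
From mathcomp Require Import all_boot.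
Set Implicit Arguments. Unset Strict Implicit. Unset Printing Implicit Defensive.

(* A loopless multigraph H with vertex type V and edge type E is given by the
   endpoint map [ends : E -> V * V]; parallel edges = distinct edges with the
   same ends. *)
Definition loopless (V E : finType) (ends : E -> V * V) : Prop :=
  forall x, (ends x).1 != (ends x).2.

Definition line_adj (V E : finType) (ends : E -> V * V) : rel E :=
  fun x y => (x != y) &&
    [|| (ends x).1 == (ends y).1, (ends x).1 == (ends y).2,
        (ends x).2 == (ends y).1 | (ends x).2 == (ends y).2].

Definition is_line_graph (T : finType) (e : rel T) : Prop :=
  exists (V E : finType) (ends : E -> V * V),
    loopless ends /\
    exists f : T -> E, bijective f /\ forall x y, e x y = line_adj ends (f x) (f y).

(* C_{t,r}: the r-cycle on 'I_r with each edge {i, i+1 mod r} replaced by t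
   parallel edges, indexed by 'I_r * 'I_t. *)
Definition Ctr_ends (t r : nat) : 'I_r * 'I_t -> 'I_r * 'I_r :=
  fun p => (p.1, ordS p.1).

Definition connected_in (T : finType) (e : rel T) (S : {set T}) : Prop :=
  forall x y, x \in S -> y \in S ->
    connect [rel a b | [&& e a b, a \in S & b \in S]] x y.

Definition k_connected (T : finType) (e : rel T) (k : nat) : Prop :=
  k < #|T| /\ forall S : {set T}, #|S| < k -> connected_in e (~: S).

(* J (on T1, adjacency e1) is a minor of G (on T2, adjacency e2), via the
   standard branch-set (model) characterisation for simple graphs. *)
Definition is_minor (T1 : finType) (e1 : rel T1) (T2 : finType) (e2 : rel T2) : Prop :=
  exists phi : T1 -> {set T2},
    [/\ forall u, phi u != set0,
        forall u, connected_in e2 (phi u),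
        forall u v, u != v -> [disjoint phi u & phi v] &
        forall u v, e1 u v -> exists x y, [/\ x \in phi u, y \in phi v & e2 x y]].

(* Main.v *)
Require Import Defs.
From mathcomp Require Import all_boot.
From mathcomp Require Import boolp zify.
Set Implicit Arguments. Unset Strict Implicit. Unset Printing Implicit Defensive.

(* Let G = L(H).  If H has a vertex of degree at least rt, G contains a clique on rt vertices
   and we are done, so H has bounded degree.  By connectivity of G two adjacent vertices of H
   have degree sum at least 30t - 13; hence the vertices of degree less than 9t are
   independent, and the set S of the others is 9t-edge-connected in H.  Packing Steiner trees
   (with splitting of the low vertices into paths of length two) yields 3t edge-disjoint
   connected subgraphs of H, each meeting all of S.
   Since H has bounded degree and S is large, each of these subgraphs contains a long comb
   with teeth in S; by the Erdos-Szekeres argument there are x_0, ..., x_(r-1) in S which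
   appear in the same order, up to reversal, along a comb of each of the 3t subgraphs.
   For each of t copies, two subgraphs provide alternately the segments from x_i to x_(i+1),
   and a third one the segment from x_(r-1) back to x_0; segments of different subgraphs
   through the same x_i are adjacent in G. *)

(** Edge-disjoint subgraphs of [H] are vertex-disjoint in [G]. After the packing all work takes
    place in [G], where a terminal is no longer a single point; hence each subgraph picks an edge at
    every [x_i]. The packing is the core. Splitting the low vertices beforehand may destroy
    edge-connectivity, so the splitting must vary together with the trees, and matroid union does
    not apply directly. Instead one takes a packing with the largest connectivity and studies all
    packings reachable from it by exchanges, which include re-pairing edge ends at a low vertex. For
    [c] classes and [m] colours at most [m * (c - 1)] further items remain. The [c] class cuts need
    [3 * m * c] edge ends in total but offer at most three per further item, so [c = 1]. With
    [m = 3t] this gives the bound [9t]. Three subgraphs serve one copy of the cycle because segments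
    of one subgraph that share a point overlap: neighbouring short segments must alternate, and the
    closing segment meets all others. *)

(** * Connectivity by a set of edges, and the forest bound on bridges *)

Section EdgeConnectivity.
Variables (T I : finType) (s t : I -> T).
Implicit Types (B P Q : {set I}) (x y z : T).

Definition eadj B : rel T :=
  [rel x y | [exists a in B, (s a == x) && (t a == y) || (s a == y) && (t a == x)]].

Definition econn B : rel T := connect (eadj B).

Lemma econn_refl B x : econn B x x.
Proof. exact: connect0. Qed.

Lemma econn_sym B x y : econn B x y = econn B y x.
Proof.
apply: sym_connect_sym => {}x {}y; rewrite /eadj /=.
by apply: eq_existsb => a; rewrite orbC.
Qed.

Lemma econn_trans B y x z : econn B x y -> econn B y z -> econn B x z.
Proof. exact: connect_trans. Qed.

Lemma econn_edge B a : a \in B -> econn B (s a) (t a).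
Proof. by move=> aB; apply/connect1/existsP; exists a; rewrite aB !eqxx. Qed.

(** [econn B] is the least equivalence relation containing the edges of [B], so inclusions need only
    be checked on edges. *)
Lemma econn_gen B (r : rel T) : reflexive r -> symmetric r -> transitive r ->
  (forall a, a \in B -> r (s a) (t a)) -> forall x y, econn B x y -> r x y.
Proof.
move=> r0 rS rT rB x y /connectP[p]; elim: p x => [|z p IHp] x /=; first by move=> _ ->.
case/andP=> /existsP[a /andP[aB xz]] /IHp/[apply]; apply: rT.
by case/orP: xz => /andP[/eqP<- /eqP<-]; last rewrite rS; exact: rB.
Qed.

Lemma econn_sub B Q : (forall a, a \in B -> econn Q (s a) (t a)) ->
  forall x y, econn B x y -> econn Q x y.
Proof.
apply: econn_gen; [exact: econn_refl | exact: econn_sym |].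
by move=> y x z; exact: econn_trans.
Qed.

Lemma econn_mono B Q : B \subset Q -> forall x y, econn B x y -> econn Q x y.
Proof. by move=> /subsetP BQ; apply: econn_sub => a /BQ; exact: econn_edge. Qed.

Lemma econn_add B a x y : econn (a |: B) x y ->
  [\/ econn B x y, econn B x (s a) /\ econn B (t a) y |
      econn B x (t a) /\ econn B (s a) y].
Proof.
pose r := [rel x y | [|| econn B x y, econn B x (s a) && econn B (t a) y |
                        econn B x (t a) && econn B (s a) y]].
suff /[apply] : forall x y, econn (a |: B) x y -> r x y.
  by case/or3P=> [|/andP|/andP]; [constructor 1 | constructor 2 | constructor 3].
apply: econn_gen => [u|u w|w u z|b]; rewrite /r /=.
- by rewrite econn_refl.
- rewrite !(econn_sym B w) (econn_sym B (s a) u) (econn_sym B (t a) u).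
  by rewrite [X in _ || (_ || X)]andbC [X in _ || (X || _)]andbC [X in _ || X]orbC
     ![econn B (_ a) w]econn_sym.
- have tr := @econn_trans B.
  case/or3P=> [uw|/andP[us tw]|/andP[ut sw]].
  + case/or3P=> [wz|/andP[ws ->]|/andP[wt ->]]; first by rewrite (tr _ _ _ uw wz).
    * by rewrite (tr _ _ _ uw ws) orbT.
    * by rewrite (tr _ _ _ uw wt) !orbT.
  + case/or3P=> [wz|/andP[ws tz]|/andP[wt sz]].
    * by rewrite us (tr _ _ _ tw wz) !orbT.
    * by rewrite us tz !orbT.
    * by rewrite (tr _ _ _ us sz).
  + case/or3P=> [wz|/andP[ws tz]|/andP[wt sz]].
    * by rewrite ut (tr _ _ _ sw wz) !orbT.
    * by rewrite (tr _ _ _ ut tz).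
    * by rewrite ut sz !orbT.
- case/setU1P=> [->|bB]; last by rewrite econn_edge.
  by rewrite !econn_refl !orbT.
Qed.

Lemma econn_del B a x y : econn B x y ->
  [\/ econn (B :\ a) x y, econn (B :\ a) x (s a) /\ econn (B :\ a) (t a) y |
      econn (B :\ a) x (t a) /\ econn (B :\ a) (s a) y].
Proof.
move=> xy; apply: econn_add; apply: econn_mono xy.
by apply/subsetP => b bB; rewrite !inE bB andbT; case: eqP.
Qed.

(** An inclusion-minimal connecting set does the work of a path: within it, every edge separates [x]
    from [y]. *)
Lemma econn_minpath B x y : econn B x y -> exists P, [/\ P \subset B, econn P x y &
  forall f, f \in P -> ~~ econn (P :\ f) x y].
Proof.
move=> xy; have [P /minsetP[cP minP] PB] :=
  @minset_exists _ (fun P => econn P x y) B xy.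
exists P; split=> // f fP; apply/negP => /minP/(_ (subsetDl _ _)) eqP.
by move: fP; rewrite -eqP !inE eqxx.
Qed.

Definition ecls B : {set {set T}} := [set [set y | econn B x y] | x : T].

Lemma ecls_lt B a : ~~ econn B (s a) (t a) -> #|ecls (a |: B)| < #|ecls B|.
Proof.
move=> nst; pose ph (C : {set T}) := \bigcup_(y in C) [set z | econn (a |: B) y z].
have sub : B \subset a |: B by apply/subsetP => b bB; rewrite !inE bB orbT.
have phE x : ph [set y | econn B x y] = [set y | econn (a |: B) x y].
  apply/setP => z; rewrite inE; apply/bigcupP/idP => [[y]|xz].
    rewrite !inE => /(econn_mono sub); exact: econn_trans.
  by exists x; rewrite inE ?econn_refl.
have -> : ecls (a |: B) = ph @: ecls B.
  by rewrite /ecls -imset_comp; apply: eq_imset => x /=; rewrite phE.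
rewrite ltn_neqAle leq_imset_card andbT; apply/negP => /imset_injP inj.
have st : econn (a |: B) (s a) (t a) by apply: econn_edge; rewrite !inE eqxx.
have := inj [set y | econn B (s a) y] [set y | econn B (t a) y].
rewrite !phE => /(_ (imset_f _ isT) (imset_f _ isT)).
suff E : [set y | econn (a |: B) (s a) y] = [set y | econn (a |: B) (t a) y].
  move/(_ E)/setP/(_ (t a)); by rewrite !inE econn_refl (negPf nst).
apply/setP => y; rewrite !inE; apply/idP/idP; last exact: econn_trans.
by apply: econn_trans; rewrite econn_sym.
Qed.

(** The edges of [Q] outside [B] are bridges of [Q], so inserting them one by one merges two classes
    each time. *)
Lemma ecls_forest B Q : B \subset Q ->
  (forall a, a \in Q :\: B -> ~~ econn (Q :\ a) (s a) (t a)) ->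
  #|Q :\: B| + #|ecls Q| <= #|ecls B|.
Proof.
move=> BQ; elim: {Q}_.+1 {-2}Q (ltnSn #|Q|) BQ => // n IHn Q ltQ BQ nr.
have [E|[a aQB]] := set_0Vmem (Q :\: B).
  by rewrite E cards0; have /eqP -> : Q == B by rewrite eqEsubset BQ -setD_eq0 E eqxx.
move: (aQB); rewrite inE => /andP[aB aQ].
have := @ecls_lt (Q :\ a) a (nr a aQB); rewrite setD1K // => lt.
rewrite (cardsD1 a Q) aQ in ltQ.
suff /(IHn (Q :\ a) ltQ) le : B \subset Q :\ a.
  have eqD : (Q :\ a) :\: B = (Q :\: B) :\ a.
    by apply/setP => b; rewrite !inE andbCA.
  rewrite eqD in le; rewrite (cardsD1 a (Q :\: B)) aQB.
  apply: leq_trans (le _); first by lia.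
  move=> b; rewrite !inE => /and3P[ba bB bQ].
  have : ~~ econn (Q :\ b) (s b) (t b) by apply: nr; rewrite !inE bB.
  by apply: contra; apply: econn_mono; apply: setSD; rewrite subsetDl.
apply/subsetP => b bB; rewrite !inE (subsetP BQ) // andbT.
by apply: contraNneq aB => <-.
Qed.

End EdgeConnectivity.

(** * Packings of coloured items and the exchanges between them *)

(* A dart d is an edge end at the terminal v d.  A group is either a non-terminal vertex,
   with its edges as darts, or an edge between two terminals, with its two ends as darts.
   An item (p, q, l) is the path of colour l from v p to v q through the common group. *)
Section Packing.
Variables (T D W : finType) (v : D -> T) (g : D -> W) (m : nat).
Notation item := (D * D * 'I_m)%type.
Implicit Types (A B P : {set item}) (a b f : item) (p q d : D) (l : 'I_m) (x y : T) (w : W).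

Definition src a := v a.1.1.
Definition tgt a := v a.1.2.
Definition uses a d := (d == a.1.1) || (d == a.1.2).
Definition joins b p q := (b.1 == (p, q)) || (b.1 == (q, p)).
Definition packing A :=
  (forall a, a \in A -> a.1.1 != a.1.2 /\ g a.1.1 = g a.1.2) /\
  (forall a b d, a \in A -> b \in A -> uses a d -> uses b d -> a = b).
Definition col A l := [set a in A | a.2 == l].
Definition spare A d := [forall a in A, ~~ uses a d].
Notation cn := (@econn T item src tgt).

Lemma spareP A d a : spare A d -> a \in A -> ~~ uses a d.
Proof. by move=> /forall_inP; apply. Qed.

Lemma joinsC b p q : joins b p q = joins b q p.
Proof. by rewrite /joins orbC. Qed.

Lemma joins_uses b p q d : joins b p q -> uses b d = (d == p) || (d == q).
Proof. by rewrite /uses => /orP[]/eqP-> //=; rewrite orbC. Qed.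

Lemma joins_ends b : joins b b.1.1 b.1.2.
Proof. by rewrite /joins; case: b => [[]] /= *; rewrite eqxx. Qed.

Lemma joins_group A b p q : packing A -> b \in A -> joins b p q ->
  [/\ p != q, g p = g q & g b.1.1 = g p].
Proof.
case: b => [[p' q'] l] [vA _] /vA[/= ne gE].
by case/orP=> /eqP[<- <-] //; rewrite eq_sym.
Qed.

Lemma joins_rel b p q (r : rel T) : symmetric r -> joins b p q ->
  r (src b) (tgt b) = r (v p) (v q).
Proof. by move=> rS; rewrite /src /tgt => /orP[]/eqP-> //=. Qed.

Lemma col_del A a l : col (A :\ a) l = col A l :\ a.
Proof. by apply/setP => b; rewrite !inE andbA. Qed.

Lemma col_add A a l : col (a |: A) l = if a.2 == l then a |: col A l else col A l.
Proof.
apply/setP => b; rewrite !inE andb_orl; case: ifP => al; rewrite !inE.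
  by case: (b =P a) => [->|]; rewrite ?al.
by case: (b =P a) => [->|] //=; rewrite al andbF.
Qed.

Lemma colS A B l : A \subset B -> col A l \subset col B l.
Proof. by move=> /subsetP AB; apply/subsetP => a; rewrite !inE => /andP[/AB -> ->]. Qed.

Lemma spareS A B d : A \subset B -> spare B d -> spare A d.
Proof. by move=> /subsetP AB /forall_inP sB; apply/forall_inP => a /AB/sB. Qed.

Lemma spare_notin A p q l : spare A p -> (p, q, l) \notin A.
Proof. by move=> sp; apply/negP => /(spareP sp); rewrite /uses eqxx. Qed.

Lemma packingS A B : A \subset B -> packing B -> packing A.
Proof.
move=> /subsetP AB [v1 v2]; split=> [a /AB /v1 //|a b d /AB aB /AB bB]; exact: v2.
Qed.

Lemma packing_add A p q l : packing A -> spare A p -> spare A q -> p != q -> g p = g q ->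
  packing ((p, q, l) |: A).
Proof.
move=> [v1 v2] sp sq pq gpq; split=> [a /setU1P[->|/v1] //|a b d].
have no c : c \in A -> uses (p, q, l) d -> uses c d -> False.
  by rewrite {1}/uses /= => cA /orP[]/eqP-> uc; move: (spareP sp cA) (spareP sq cA); rewrite uc.
move=> /setU1P[->|aA] /setU1P[->|bA] // ua ub.
- by case: (no b bA).
- by case: (no a aA).
- exact: v2 ua ub.
Qed.

Lemma spare_del A a d : packing A -> a \in A -> uses a d -> spare (A :\ a) d.
Proof.
move=> [_ v2] aA ua; apply/forall_inP => b; rewrite !inE => /andP[/eqP ba bA].
by apply/negP => ub; apply: ba; exact: v2 ub ua.
Qed.

Lemma spare_add A p q l d : spare A d -> d != p -> d != q -> spare ((p, q, l) |: A) d.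
Proof.
move=> sd dp dq; apply/forall_inP => b /setU1P[->|/(spareP sd)] //.
by rewrite /uses negb_or dp.
Qed.

(* Maximality only for inclusion of the m connectivity relations. *)
Definition saturated A := packing A /\ forall A', packing A' ->
  (forall l x y, cn (col A l) x y -> cn (col A' l) x y) ->
  forall l x y, cn (col A' l) x y -> cn (col A l) x y.

(** Maximise the number of connected pairs, summed over the colours: a relation that grows without
    gaining pairs stays the same. *)
Lemma saturated_exists : exists A, saturated A.
Proof.
pose Phi A := \sum_l #|[set xy : T * T | cn (col A l) xy.1 xy.2]|.
have p0 : packing set0 by split=> [a|a b d]; rewrite inE.
case: (@arg_maxnP _ set0 (fun A => `[< packing A >]) Phi); first exact/asboolP.
move=> A /asboolP pA maxA; exists A; split=> // A' pA' sub l x y.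
have {}maxA : Phi A' <= Phi A by apply: maxA; exact/asboolP.
have ss k : [set xy : T * T | cn (col A k) xy.1 xy.2] \subset
            [set xy : T * T | cn (col A' k) xy.1 xy.2].
  by apply/subsetP => -[u z]; rewrite !inE; exact: sub.
have le k := subset_leq_card (ss k).
have [lt|ge] := ltnP #|[set xy : T * T | cn (col A l) xy.1 xy.2]|
                     #|[set xy : T * T | cn (col A' l) xy.1 xy.2]|.
  suff : Phi A < Phi A' by rewrite ltnNge => /negP; case.
  rewrite /Phi (bigD1 l) //= [X in _ < X](bigD1 l) //= -addSn leq_add //.
  by apply: leq_sum => k _.
have /eqP E : [set xy : T * T | cn (col A l) xy.1 xy.2] ==
              [set xy : T * T | cn (col A' l) xy.1 xy.2] by rewrite eqEcard ss.
by move/setP/(_ (x, y)): E; rewrite !inE /= => ->.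
Qed.

Variables (A0 : {set item}) (satA0 : saturated A0).

(* None of these steps changes the connectivity relation of any colour. *)
Inductive reach : {set item} -> Prop :=
| reach0 : reach A0
| reach_del A a : reach A -> a \in A -> cn (col A a.2 :\ a) (src a) (tgt a) ->
    reach (A :\ a)
| reach_add A p q l : reach A -> spare A p -> spare A q -> p != q -> g p = g q ->
    reach ((p, q, l) |: A)
| reach_swap A b p q p' q' : reach A -> b \in A -> joins b p' q' ->
    spare A p -> spare A q -> p != q -> g p = g q -> g p = g p' ->
    cn (col A b.2 :\ b) (v p) (v p') -> reach ((p, q', b.2) |: (A :\ b)).

Lemma cn_del A a l x y : cn (col A a.2 :\ a) (src a) (tgt a) ->
  cn (col (A :\ a) l) x y = cn (col A l) x y.
Proof.
rewrite col_del => aR; apply/idP/idP; first exact/econn_mono/subsetDl.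
apply: econn_sub => c cA; have [ca|ca] := eqVneq c a; last first.
  by apply: econn_edge; rewrite !inE ca; rewrite inE in cA.
by move: cA; rewrite ca inE => /andP[_ /eqP <-].
Qed.

(** No step loses a connection: a deleted item is redundant, and a swapped item is rerouted along
    the surviving connection from [v p] to [v p']. Saturation of [A0] then excludes any gain. *)
Lemma reach_inv A : reach A ->
  packing A /\ forall l x y, cn (col A l) x y = cn (col A0 l) x y.
Proof.
have noGain B B' : packing B' ->
    (forall l x y, cn (col B l) x y = cn (col A0 l) x y) ->
    (forall l x y, cn (col B l) x y -> cn (col B' l) x y) ->
    forall l x y, cn (col B' l) x y = cn (col A0 l) x y.
  move=> pB' eB sub l x y; apply/idP/idP; last by rewrite -eB; exact: sub.
  by apply: satA0.2 => // {}l {}x {}y; rewrite -eB; exact: sub.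
elim=> {A} [|A a _ [pA eA] aA aR|A p q l _ [pA eA] sp sq pq gpq|
            A b p q p' q' _ [pA eA] bA bj sp sq pq gpq gpp pp'].
- by split=> //; case: satA0.
- by split=> [|l x y]; [exact: packingS (subsetDl _ _) pA | rewrite cn_del].
- have pA' := packing_add l pA sp sq pq gpq; split=> //.
  apply: noGain eA _ => // k x y; apply: econn_mono; apply: colS; exact: subsetUr.
have [p'q' gq' gb] := joins_group pA bA bj.
have pq' : p != q'.
  by apply: contraNneq (spareP sp bA) => ->; rewrite (joins_uses _ bj) eqxx orbT.
have pA' : packing ((p, q', b.2) |: (A :\ b)).
  apply: packing_add; rewrite ?gpp //.
  - exact: packingS (subsetDl _ _) pA.
  - exact: spareS (subsetDl _ _) sp.
  - by apply: spare_del => //; rewrite (joins_uses _ bj) eqxx orbT.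
split=> //; apply: noGain eA _ => // l x y; apply: econn_sub => c.
rewrite inE => /andP[cA cl]; have [ecb|cb] := eqVneq c b; last first.
  by apply: econn_edge; rewrite !inE cb cA cl orbT.
move: cl; rewrite ecb => /eqP bl.
have -> : cn (col ((p, q', b.2) |: A :\ b) l) (src b) (tgt b) =
          cn (col ((p, q', b.2) |: A :\ b) l) (v p') (v q').
  by apply: joins_rel => //; exact: econn_sym.
rewrite col_add /= bl eqxx col_del; apply: (econn_trans (y := v p)); last first.
  by apply: (@econn_edge _ _ src tgt _ (p, q', l)); rewrite !inE eqxx.
by rewrite econn_sym; move: pp'; rewrite bl; apply/econn_mono/subsetUr.
Qed.

Lemma noGain A B : reach A -> packing B ->
  (forall l x y, cn (col A l) x y -> cn (col B l) x y) ->
  forall l x y, cn (col B l) x y -> cn (col A l) x y.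
Proof.
move=> /reach_inv[_ eA] pB sub l x y; rewrite eA; apply: satA0.2 => //.
by move=> k x' y'; rewrite -eA; exact: sub.
Qed.

(** Otherwise adding the item [(p, q, l)] would connect more. *)
Lemma spare_conn A p q l : reach A -> spare A p -> spare A q -> g p = g q ->
  cn (col A l) (v p) (v q).
Proof.
have [->|pq] := eqVneq p q; first by rewrite econn_refl.
move=> rA sp sq gpq; have [pA eA] := reach_inv rA.
have [_ eB] := reach_inv (reach_add l rA sp sq pq gpq).
rewrite eA -eB; apply: (@econn_edge _ _ src tgt _ (p, q, l)).
by rewrite !inE !eqxx.
Qed.


(** * Glued classes and inner items *)

(** After some exchanges an item of any colour could be added between the two terminals; the
    analogue of the elements reached by exchanges in the matroid partition argument. *)
Definition free x y := exists A p q,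
  [/\ reach A, spare A p, spare A q, g p = g q & v p = x /\ v q = y].
Definition glued : rel T := connect [rel x y | `[< free x y >]].
Definition loose w := exists A p q,
  [/\ reach A, spare A p, spare A q, p != q & g p = w /\ g q = w].
(* An item that becomes redundant in some reachable state is inner; conversely the classes
   of [glued] turn out to be connected by inner items alone, in every colour. *)
Definition inner a := `[< loose (g a.1.1) >] && glued (src a) (tgt a).
Definition inn A l := [set a in col A l | inner a].
Definition crossing A w := [set a in A | (g a.1.1 == w) && ~~ glued (src a) (tgt a)].

Lemma glued_sym : symmetric glued.
Proof.
apply: sym_connect_sym => x y /=; apply: asbool_equiv_eq.
by split=> -[A [p [q [rA sp sq gpq [vp vq]]]]]; exists A, q, p.
Qed.

Lemma glued_refl x : glued x x. Proof. exact: connect0. Qed.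

Lemma glued_trans y x z : glued x y -> glued y z -> glued x z.
Proof. exact: connect_trans. Qed.

Lemma glued_spare A p q : reach A -> spare A p -> spare A q -> g p = g q ->
  glued (v p) (v q).
Proof. by move=> *; apply/connect1/asboolP; exists A, p, q. Qed.

(** Deleting [a] leaves both its darts spare in a reachable packing. *)
Lemma redundant_inner A a : reach A -> a \in A ->
  cn (col A a.2 :\ a) (src a) (tgt a) -> inner a.
Proof.
move=> rA aA aR; have rA' := reach_del rA aA aR.
have [pA _] := reach_inv rA; have [ne ge] := pA.1 a aA.
have s1 : spare (A :\ a) a.1.1 by apply: spare_del => //; rewrite /uses eqxx.
have s2 : spare (A :\ a) a.1.2 by apply: spare_del => //; rewrite /uses eqxx orbT.
rewrite /inner; apply/andP; split; last exact: glued_spare rA' s1 s2 ge.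
by apply/asboolP; exists (A :\ a), a.1.1, a.1.2.
Qed.

(** [P] acts as a path from [x] to [y]; the detour in [B :\ f] closes a cycle through [f]. *)
Lemma path_item_redundant P B f x y : P \subset B -> f \in P ->
  ~~ cn (P :\ f) x y -> cn P x y -> cn (B :\ f) x y -> cn (B :\ f) (src f) (tgt f).
Proof.
move=> PB fP nxy xy Bxy.
have sub : P :\ f \subset B :\ f by apply: setSD.
have [|[/(econn_mono sub) xs /(econn_mono sub) ty]|
       [/(econn_mono sub) xt /(econn_mono sub) sy]] := econn_del f xy.
- by rewrite (negPf nxy).
- by rewrite econn_sym in xs; rewrite econn_sym in ty;
    apply: econn_trans xs (econn_trans Bxy ty).
- rewrite econn_sym in Bxy.
  by apply: econn_trans sy (econn_trans Bxy xt).
Qed.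

(** A minimal path between the ends of [a] forms a cycle with [a]; so each item of the path is
    redundant as well, hence inner. *)
Lemma cycle_inner A a : reach A -> a \in A ->
  cn (col A a.2 :\ a) (src a) (tgt a) -> cn (inn A a.2 :\ a) (src a) (tgt a).
Proof.
move=> rA aA /econn_minpath[P [PB cP minP]].
apply: econn_mono (cP); apply/subsetP => f fP.
have := subsetP PB f fP; rewrite !inE => /and3P[-> fA /eqP fl].
rewrite fA fl eqxx /=; apply: redundant_inner rA fA _; rewrite fl.
apply: path_item_redundant (minP f fP) cP _ => //.
  exact: subset_trans PB (subsetDl _ _).
apply: econn_edge; rewrite !inE aA eqxx !andbT.
by apply: contraTneq fP => <-; apply: contraTN isT => /(subsetP PB); rewrite !inE eqxx.
Qed.

Lemma inn_del A a l x y : reach A -> a \in A ->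
  cn (col A a.2 :\ a) (src a) (tgt a) -> cn (inn (A :\ a) l) x y = cn (inn A l) x y.
Proof.
move=> rA aA /(cycle_inner rA aA) aR.
have E : inn (A :\ a) l = inn A l :\ a by apply/setP => c; rewrite !inE -!andbA.
rewrite E; apply/idP/idP; first exact/econn_mono/subsetDl.
apply: econn_sub => c cA; have [ca|ca] := eqVneq c a; last first.
  by apply: econn_edge; rewrite !inE ca; rewrite !inE in cA.
by move: cA; rewrite ca !inE => /andP[/andP[_ /eqP <-] _].
Qed.

(** This is [inn_del] read backwards: the new item is redundant by [spare_conn]. *)
Lemma inn_add A p q k l x y : reach A -> spare A p -> spare A q -> p != q -> g p = g q ->
  cn (inn ((p, q, k) |: A) l) x y = cn (inn A l) x y.
Proof.
move=> rA sp sq pq gpq; have rA' := reach_add k rA sp sq pq gpq.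
have E : ((p, q, k) |: A) :\ (p, q, k) = A.
  by rewrite setU1K // spare_notin.
rewrite -[in RHS]E inn_del ?setU11 // -col_del E /=.
exact: (spare_conn k rA sp sq gpq).
Qed.

(** * Exchanging a dart of an item for a spare dart of its group *)

Section Swap.
Variables (A : {set item}) (b : item) (p q p' q' : D).
Hypotheses (rA : reach A) (bA : b \in A) (bj : joins b p' q').
Hypotheses (sp : spare A p) (sq : spare A q) (pq : p != q).
Hypotheses (gpq : g p = g q) (gpp : g p = g p').
Hypothesis pp' : cn (col A b.2 :\ b) (v p) (v p').
Let b' : item := (p, q', b.2).
Let A' := b' |: (A :\ b).

Let rA' : reach A'. Proof. exact: (reach_swap rA bA bj sp sq). Qed.
Let pA : packing A. Proof. exact: (reach_inv rA).1. Qed.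
Let p'q' : p' != q'. Proof. by have [] := joins_group pA bA bj. Qed.
Let gq' : g p' = g q'. Proof. by have [] := joins_group pA bA bj. Qed.
Let gb : g b.1.1 = g p'. Proof. by have [] := joins_group pA bA bj. Qed.
Let ub d : uses b d = (d == p') || (d == q'). Proof. exact: joins_uses. Qed.

Let dist d d' : spare A d -> uses b d' -> d != d'.
Proof. by move=> sd ud; apply: contraTneq ud => <-; exact: spareP bA. Qed.

Lemma swap_spare : spare A' q /\ spare A' p'.
Proof.
have up' : uses b p' by rewrite ub eqxx.
have uq' : uses b q' by rewrite ub eqxx orbT.
split; apply: spare_add.
- exact: spareS (subsetDl _ _) sq.
- by rewrite eq_sym.
- exact: dist.
- exact: spare_del.
- by rewrite eq_sym dist.
- exact: p'q'.
Qed.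

(** The dart [q] is spare throughout: together with [p] before the swap, and with [p'] after it. *)
Lemma swap_glued : glued (v p) (v p').
Proof.
have [sq' sp'] := swap_spare.
apply: (@glued_trans (v q)); first exact: glued_spare rA sp sq gpq.
by apply: glued_spare rA' sq' sp' _; rewrite -gpq.
Qed.

Lemma swap_inner : inner b' = inner b.
Proof.
rewrite /inner /= gb gpp; congr (_ && _).
rewrite (joins_rel glued_sym bj) /src /tgt /=.
apply/idP/idP; apply: glued_trans; last exact: swap_glued.
by rewrite glued_sym swap_glued.
Qed.

(* Adding the item (p, q) to A, or (q, p') to A', closes a cycle through every
   item of a minimal path from p to p'. *)
Lemma swap_path : cn (inn A b.2 :\ b) (v p) (v p').
Proof.
have [P [PB cP minP]] := econn_minpath pp'.
apply: econn_mono (cP); apply/subsetP => f fP; move: PB; set l := b.2 => PB.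
have := subsetP PB f fP; rewrite !inE => /and3P[fb fA /eqP fl].
rewrite fb fA fl eqxx /=.
have fin B : reach B -> P \subset col B l -> cn (col B l :\ f) (v p) (v p') -> inner f.
  move=> rB PcB pp; have fB : f \in B by have := subsetP PcB f fP; rewrite inE => /andP[].
  apply: redundant_inner rB fB _; rewrite fl.
  exact: path_item_redundant PcB fP (minP f fP) cP pp.
set Zf := col A l :\ b :\ f.
have fpq d d' k : spare A d -> f != (d, d', k).
  by move=> sd; apply: contraTneq fA => ->; exact: spare_notin.
have Pend u : cn Zf (v q) u -> (u == src f) || (u == tgt f) ->
    cn Zf (v q) (v p) \/ cn Zf (v q) (v p').
  have sub : P :\ f \subset Zf by apply: setSD.
  have [|[/(econn_mono sub) xs /(econn_mono sub) ty]|
       [/(econn_mono sub) xt /(econn_mono sub) sy]] := econn_del f cP.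
  - by rewrite (negPf (minP f fP)).
  - move=> qu /orP[]/eqP uE; rewrite {}uE in qu.
      by left; apply: econn_trans qu _; rewrite econn_sym.
    by right; apply: econn_trans qu _.
  - move=> qu /orP[]/eqP uE; rewrite {}uE in qu.
      by right; apply: econn_trans qu _.
    by left; apply: econn_trans qu _; rewrite econn_sym.
have Zdel u : cn (col A l :\ b) (v q) u ->
    [\/ cn Zf (v q) u, cn Zf (v q) (v p) | cn Zf (v q) (v p')].
  move=> /(econn_del f)[qu|[qs _]|[qt _]]; first by constructor 1.
    by case: (Pend _ qs); rewrite ?eqxx //; [constructor 2 | constructor 3].
  by case: (Pend _ qt); rewrite ?eqxx ?orbT //; [constructor 2 | constructor 3].
(* Take the connection of [v q] and [v p] given by [spare_conn] and remove [b], then [f]. If it is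
   broken at [f], the rest of [P] leads from that end of [f] to [v p] or [v p']. *)
have key : [\/ cn Zf (v q) (v q'), cn Zf (v q) (v p) | cn Zf (v q) (v p')].
  have qp : cn (col A l) (v q) (v p) by apply: spare_conn.
  have Zp : cn (col A l :\ b) (v q) (v p) ->
    [\/ cn Zf (v q) (v q'), cn Zf (v q) (v p) | cn Zf (v q) (v p')].
    by case/Zdel => ?; [constructor 2 | constructor 2 | constructor 3].
  have bE : (src b = v p' /\ tgt b = v q') \/ (src b = v q' /\ tgt b = v p').
    by rewrite /src /tgt; case/orP: bj => /eqP-> /=; [left | right].
  have [/Zp //|[qs tp]|[qt sp0]] := econn_del b qp.
    case: bE => -[sE tE]; rewrite sE tE in qs tp; last exact: Zdel.
    by apply: Zp; apply: econn_trans qs _; rewrite econn_sym.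
  case: bE => -[sE tE]; rewrite sE tE in qt sp0; first exact: Zdel.
  by apply: Zp; apply: econn_trans qt _; rewrite econn_sym.
have PA : P \subset col A l by apply: subset_trans PB (subsetDl _ _).
have Apq : cn (col ((p, q, l) |: A) l :\ f) (v p) (v q).
  apply: (@econn_edge _ _ src tgt _ (p, q, l)).
  by rewrite !inE !eqxx !andbT eq_sym; exact: fpq.
have ZfS : Zf \subset col ((p, q, l) |: A) l :\ f.
  by apply/subsetP => c; rewrite !inE => /and4P[-> _ -> ->]; rewrite orbT.
have rApq := reach_add l rA sp sq pq gpq.
have PApq : P \subset col ((p, q, l) |: A) l.
  by apply: subset_trans PA (colS _ (subsetUr _ _)).
case: key => [qq'|qp|qp'].
- apply: fin rApq PApq _; apply: econn_trans Apq _.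
  apply: econn_trans (econn_mono ZfS qq') _.
  have : cn (col ((p, q, l) |: A) l :\ f) (src b) (tgt b).
    by apply: econn_edge; rewrite !inE bA eqxx orbT eq_sym fb.
  rewrite (joins_rel _ bj); last exact: econn_sym.
  by rewrite econn_sym.
- have [sq' sp'] := swap_spare.
  have qp' : q != p' by apply: dist; rewrite // ub eqxx.
  have rB := reach_add l rA' sq' sp' qp' (etrans (esym gpq) gpp).
  apply: fin rB _ _.
    apply/subsetP => c /(subsetP PB); rewrite !inE => /and3P[-> -> ->].
    by rewrite !orbT.
  apply: (econn_trans (y := v q)).
    rewrite econn_sym; apply: econn_mono qp; apply/subsetP => c; rewrite !inE.
    by case/and4P=> -> -> -> ->; rewrite !orbT.
  apply: (@econn_edge _ _ src tgt _ (q, p', l)).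
  by rewrite !inE !eqxx !andbT eq_sym; exact: fpq.
- by apply: fin rApq PApq _; apply: econn_trans Apq _; exact: econn_mono qp'.
Qed.

Lemma swap_inn l x y : cn (inn A' l) x y = cn (inn A l) x y.
Proof.
have bS B : cn B (src b) (tgt b) = cn B (v p') (v q').
  by apply: joins_rel bj; exact: econn_sym.
apply/idP/idP; apply: econn_sub => c; rewrite !inE.
  case/andP=> /andP[/orP[/eqP->|/andP[cb cA]] cl] ci; last first.
    by apply: econn_edge; rewrite !inE cA cl.
  move: cl => /= /eqP<-.
  have bi : b \in inn A b.2 by rewrite !inE bA eqxx -swap_inner.
  have := econn_edge src tgt bi; rewrite bS; apply: econn_trans.
  by apply: econn_mono swap_path; exact: subsetDl.
case/andP=> /andP[cA cl] ci; have [cb|cb] := eqVneq c b; last first.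
  by apply: econn_edge; rewrite !inE cA cl cb orbT.
move: cl; rewrite cb => /eqP<-; rewrite bS.
apply: (econn_trans (y := v p)).
  rewrite econn_sym; apply: econn_mono swap_path; apply/subsetP => d.
  by rewrite !inE => /andP[-> /andP[/andP[-> ->] ->]]; rewrite orbT.
apply: (@econn_edge _ _ src tgt _ b').
by rewrite !inE !eqxx -/b' swap_inner -cb.
Qed.

Lemma swap_crossing w : #|crossing A' w| = #|crossing A w|.
Proof.
have cE : glued (src b') (tgt b') = glued (src b) (tgt b).
  rewrite (joins_rel glued_sym bj) /src /tgt /=.
  apply/idP/idP; apply: glued_trans; last exact: swap_glued.
  by rewrite glued_sym swap_glued.
have b'A : b' \notin A by exact: spare_notin.
have E : crossing A' w :\ b' = crossing A w :\ b.
  apply/setP => c; rewrite !inE; have [->|cb'] /= := eqVneq c b'.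
    by rewrite (negPf b'A) !andbF.
  by rewrite !andbA.
rewrite (cardsD1 b') (cardsD1 b (crossing A w)) E; congr (_ + _).
by rewrite !inE eqxx bA cE /= gb gpp.
Qed.

End Swap.

Lemma reach_inn A l x y : reach A -> cn (inn A l) x y = cn (inn A0 l) x y.
Proof.
move=> rA; elim: rA l x y => {A} // [A a rA IH aA aR|A p q k rA IH sp sq pq gpq|
   A b p q p' q' rA IH bA bj sp sq pq gpq gpp pp'] l x y.
- by rewrite inn_del.
- by rewrite inn_add.
- by rewrite (swap_inn rA bA bj sp sq pq gpq gpp pp').
Qed.

Lemma reach_crossing A w : reach A -> #|crossing A w| = #|crossing A0 w|.
Proof.
elim=> {A} // [A a rA <- aA aR|A p q k rA <- sp sq pq gpq|
   A b p q p' q' rA <- bA bj sp sq pq gpq gpp pp'].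
- have /andP[_ ag] := redundant_inner rA aA aR.
  apply: eq_card => c; rewrite !inE; have [->|//] := eqVneq c a.
  by rewrite ag /= !andbF.
- apply: eq_card => c; rewrite !inE; have [->|//] := eqVneq c (p, q, k).
  have -> : glued (src (p, q, k)) (tgt (p, q, k)) by exact: (glued_spare rA).
  by rewrite !andbF.
- exact: (swap_crossing rA bA bj sp sq pq gpq gpp pp').
Qed.

(** A free pair can be joined by a new item of colour [l], which is inner; [reach_inn] carries this
    connection back to [A0]. *)
Lemma glued_inn l x y : glued x y = cn (inn A0 l) x y.
Proof.
apply/idP/idP.
  move=> /connectP[s]; elim: s x => [|z s IHs] x /=; first by move=> _ ->; exact: econn_refl.
  case/andP=> /asboolP[A [p [q [rA sp sq gpq [<- <-]]]]] /IHs/[apply].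
  apply: econn_trans; have [->|pq] := eqVneq p q; first exact: econn_refl.
  have rA' := reach_add l rA sp sq pq gpq; rewrite -(reach_inn _ _ _ rA').
  apply: (@econn_edge _ _ src tgt _ (p, q, l)); rewrite !inE !eqxx /=.
  apply/andP; split; last exact: glued_spare rA sp sq gpq.
  by apply/asboolP; exists A, p, q.
apply: econn_gen; [exact: glued_refl | exact: glued_sym | |].
  by move=> z u w; exact: glued_trans.
by move=> a; rewrite !inE => /andP[_ /andP[]].
Qed.


(* Otherwise replacing b by (p, p') and (q, q') would connect more terminals. *)
Lemma item_end A b p q p' q' : reach A -> b \in A -> joins b p' q' ->
  spare A p -> spare A q -> p != q -> g p = g q -> g p = g p' ->
  glued (v p) (v p') || glued (v p) (v q').
Proof.
move=> rA bA bj sp sq pq gpq gpp; apply/norP => -[np' nq'].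
have [pA _] := reach_inv rA.
have [p'q' gq' _] := joins_group pA bA bj.
have bj' : joins b q' p' by rewrite joinsC.
have gpq_ := glued_spare rA sp sq gpq.
set Z := col A b.2 :\ b.
have Zpp' : ~~ cn Z (v p) (v p').
  by apply: contra np' => Zp; exact: swap_glued bj sp sq pq gpq gpp Zp.
have Zpq' : ~~ cn Z (v p) (v q').
  by apply: contra nq' => Zp; exact: swap_glued bj' sp sq pq gpq (etrans gpp gq') Zp.
have Zpq : cn Z (v p) (v q).
  have [//|[ps _]|[pt _]] := econn_del b (spare_conn b.2 rA sp sq gpq).
    by case/orP: bj => /eqP bE; rewrite /src bE /= ?(negPf Zpp') ?(negPf Zpq') in ps.
  by case/orP: bj => /eqP bE; rewrite /tgt bE /= ?(negPf Zpp') ?(negPf Zpq') in pt.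
have ub d : uses b d = (d == p') || (d == q') by exact: joins_uses.
have dist d d' : spare A d -> uses b d' -> d != d'.
  by move=> sd ud; apply: contraTneq ud => <-; exact: spareP bA.
have up' : uses b p' by rewrite ub eqxx.
have uq' : uses b q' by rewrite ub eqxx orbT.
have sub : A :\ b \subset A by exact: subsetDl.
set B := (p, p', b.2) |: ((q, q', b.2) |: (A :\ b)).
have pB : packing B.
  apply: packing_add => //; last exact: dist.
  - apply: packing_add (spareS sub sq) _ _ _; rewrite -?gpq ?gpp //.
    + exact: packingS sub pA.
    + exact: spare_del.
    + exact: dist.
  - by apply: spare_add (spareS sub sp) pq _; exact: dist.
  - by apply: spare_add; [exact: spare_del | rewrite eq_sym dist | ].
have ZB : Z \subset col B b.2.
  by apply/subsetP => c; rewrite !inE => /and3P[-> -> ->]; rewrite !orbT.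
have Bpp' : cn (col B b.2) (v p) (v p').
  by apply: (@econn_edge _ _ src tgt _ (p, p', b.2)); rewrite !inE !eqxx.
have Bqq' : cn (col B b.2) (v q) (v q').
  by apply: (@econn_edge _ _ src tgt _ (q, q', b.2)); rewrite !inE !eqxx !orbT.
(* In [B] the item [b] is replaced by the route from [v p'] over [v p] and [v q] to [v q']. *)
have AB l x y : cn (col A l) x y -> cn (col B l) x y.
  apply: econn_sub => c cA; have [cb|cb] := eqVneq c b; last first.
    by apply: econn_edge; move: cA; rewrite !inE cb => /andP[-> ->]; rewrite !orbT.
  move: cA; rewrite cb inE => /andP[_ /eqP <-].
  rewrite (joins_rel _ bj); last exact: econn_sym.
  apply: econn_trans (econn_trans (econn_mono ZB Zpq) Bqq').
  by rewrite econn_sym.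
have [|[ps _]|[pt _]] := econn_del b (noGain rA pB AB Bpp').
- exact/negP.
- by case/orP: bj => /eqP bE; rewrite /src bE /= ?(negPf Zpp') ?(negPf Zpq') in ps.
- by case/orP: bj => /eqP bE; rewrite /tgt bE /= ?(negPf Zpp') ?(negPf Zpq') in pt.
Qed.

(** * Counting darts over the cuts of the glued classes *)

Definition gclass x := [set y | glued x y].
Definition gclasses := [set gclass x | x : T].
Definition outer w := [set a in A0 | (g a.1.1 == w) && ~~ inner a].

Lemma gclass_eq x y : (gclass x == gclass y) = glued x y.
Proof.
apply/eqP/idP => [/setP/(_ y)|xy]; first by rewrite !inE glued_refl.
apply/setP => z; rewrite !inE; apply/idP/idP; apply: glued_trans => //.
by rewrite glued_sym.
Qed.

(** In each colour the items that are not inner are bridges, while the inner ones span exactly the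
    glued classes; the forest bound applies. *)
Lemma outer_sum (x0 : T) : \sum_w #|outer w| <= m * #|gclasses|.-1.
Proof.
have -> : \sum_w #|outer w| = #|[set a in A0 | ~~ inner a]|.
  rewrite -sum1_card (partition_big (fun a => g a.1.1) predT) //=.
  apply: eq_bigr => w _; rewrite -sum1_card; apply: eq_bigl => a.
  by rewrite !inE; case: (a \in A0); case: (_ == w); case: (inner a).
rewrite -sum1_card (partition_big (fun a => a.2) predT) //=.
rewrite -[m in m * _]card_ord -sum_nat_const; apply: leq_sum => l _.
have eE : ecls src tgt (inn A0 l) = gclasses.
  by apply: eq_imset => x; apply/setP => y; rewrite !inE (glued_inn l).
have innS : inn A0 l \subset col A0 l by apply/subsetP => a; rewrite !inE => /andP[].
have := @ecls_forest _ _ src tgt _ _ innS; rewrite eE => le.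
have : #|col A0 l :\: inn A0 l| + #|ecls src tgt (col A0 l)| <= #|gclasses|.
  apply: le => a; rewrite !inE negb_and => /andP[/orP[/negPf->//|na]].
  move=> /andP[aA /eqP al]; apply: contra na; rewrite -al.
  exact: redundant_inner reach0 aA.
have : 0 < #|ecls src tgt (col A0 l)|.
  by apply/card_gt0P; exists [set y | cn (col A0 l) x0 y]; exact: imset_f.
have -> : \sum_(i in [set a in A0 | ~~ inner a] | i.2 == l) 1 =
  #|col A0 l :\: inn A0 l|.
  rewrite -sum1_card; apply: eq_bigl => a; rewrite !inE.
  by case: (a \in A0); case: (a.2 == l); case: (inner a).
have aux (n1 n2 n3 : nat) : 0 < n2 -> n1 + n2 <= n3 -> n1 <= n3.-1 by lia.
exact: aux.
Qed.

(** Let [x] be the terminal of a spare dart in a reachable packing with two spare darts at [w]. Any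
    dart of [w] leading outside the class of [x] is used, and by [item_end] its item has the other
    end inside. So these darts belong to distinct crossing items, whose number is the same in
    [A0]. *)
Lemma loose_darts w : loose w -> exists x,
  #|[set d | (g d == w) && ~~ glued x (v d)]| <= #|outer w|.
Proof.
move=> lw; have [A [p [q [rA sp sq pq [gp gq]]]]] := lw.
exists (v p); have [pA _] := reach_inv rA.
have -> : outer w = crossing A0 w.
  apply/setP => a; rewrite !inE; case: eqP => [gw|]; rewrite ?andbF //=.
  by rewrite /inner gw asboolT.
rewrite -(reach_crossing w rA).
pose ph a := if glued (v p) (v a.1.1) then a.1.2 else a.1.1.
apply: leq_trans (leq_imset_card ph _); apply: subset_leq_card.
apply/subsetP => d; rewrite inE => /andP[/eqP gd nd].
have : ~~ spare A d.
  by apply: contra nd => sd; apply: glued_spare rA sp sd _; rewrite gp gd.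
rewrite negb_forall_in => /exists_inP[a aA]; rewrite negbK => ud.
have ends d' : joins a d' d -> glued (v p) (v d') && (a \in crossing A w).
  move=> aj; have [dd' gdd' ga] := joins_group pA aA aj.
  have gpd' : g p = g d' by rewrite gp gdd' gd.
  have := item_end rA aA aj sp sq pq (etrans gp (esym gq)) gpd'.
  rewrite (negPf nd) orbF => gd'; rewrite gd' !inE aA ga gdd' gd eqxx /=.
  rewrite (joins_rel glued_sym aj); apply: contra nd; exact: glued_trans.
apply/imsetP; case/orP: ud => /eqP dE.
  have /ends/andP[g2 ac] : joins a a.1.2 d by rewrite dE joinsC joins_ends.
  by exists a; rewrite // /ph -dE (negPf nd).
have /ends/andP[g1 ac] : joins a a.1.1 d by rewrite dE joins_ends.
by exists a; rewrite // /ph g1.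
Qed.

(** At most one dart is spare, and every item at [w] is outer and uses two darts. *)
Lemma nonloose_darts w : ~ loose w -> #|[set d | g d == w]| <= 2 * #|outer w| + 1.
Proof.
move=> nlw; have [pA _] := satA0.
pose f1 (a : item) := a.1.1; pose f2 (a : item) := a.1.2.
pose S := [set d | (g d == w) && spare A0 d].
have sub : [set d | g d == w] \subset (f1 @: outer w :|: f2 @: outer w) :|: S.
  apply/subsetP => d; rewrite inE => /eqP gd; rewrite in_setU [d \in S]inE gd eqxx /=.
  have [|] := boolP (spare A0 d); rewrite ?orbT // orbF.
  rewrite negb_forall_in => /exists_inP[a aA]; rewrite negbK => ud.
  have ao : a \in outer w.
    have [_ gE] := pA.1 a aA.
    have ga : g a.1.1 = w by case/orP: ud => /eqP dE; rewrite -gd dE.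
    by rewrite !inE aA ga eqxx /inner asboolF // ga.
  by case/orP: ud => /eqP ->; apply/setUP; [left | right]; exact: imset_f.
have S1 : #|S| <= 1.
  rewrite leqNgt; apply/card_gt1P => -[p [q []]]; rewrite !inE.
  move=> /andP[/eqP gp sp] /andP[/eqP gq sq] pq; apply: nlw.
  by exists A0, p, q; split=> //; exact: reach0.
apply: leq_trans (subset_leq_card sub) _.
apply: leq_trans (leq_card_setU _ _) (leq_add _ S1).
apply: leq_trans (leq_card_setU _ _) _.
by rewrite mul2n -addnn; apply: leq_add; exact: leq_imset_card.
Qed.

Lemma set0_gclass : set0 \notin gclasses.
Proof.
by apply/imsetP => -[x _ /setP/(_ x)]; rewrite !inE glued_refl.
Qed.

(* U is the class on whose side of the cuts the group w is placed; set0, which is not a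
   class, puts w on the far side of every cut. *)
Lemma group_assignment w : exists U : {set T},
  \sum_(d | g d == w) (gclass (v d) != U) * (1 + (U \in gclasses)) <= 3 * #|outer w|.
Proof.
have [lw|nlw] := pselect (loose w).
  have [x le] := loose_darts lw; exists (gclass x).
  rewrite imset_f // -big_distrl /= -big_mkcondr /=.
  apply: leq_trans (_ : #|outer w| * 2 <= _); last by rewrite mulnC leq_mul2r orbT.
  rewrite leq_mul2r /=; apply: leq_trans le; rewrite -sum1_card.
  rewrite [X in _ <= X](eq_bigl (fun d => (g d == w) && (gclass (v d) != gclass x))).
    by rewrite big_mkcondr /=; apply: leq_sum => d _; case: (_ != _).
  by move=> d; rewrite !inE gclass_eq glued_sym.
have le := nonloose_darts nlw.
(* The factor 3 arises here: [2 * o + 1 <= 3 * o] for [o > 0]. Without outer items, [w] has at most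
   one dart and is put on the side of its class. *)
have [o0|o0] := posnP #|outer w|; last first.
  exists set0; rewrite (negPf set0_gclass).
  apply: leq_trans (_ : #|[set d | g d == w]| <= _); last first.
    by apply: leq_trans le _; rewrite (mulnDl 2 1) leq_add2l mul1n.
  rewrite -sum1_card [X in _ <= X](eq_bigl (fun d => g d == w)) => [|d]; rewrite ?inE //.
  by apply: leq_sum => d _; case: (_ != _).
rewrite o0 in le *; have [E|[d dw]] := set_0Vmem [set d | g d == w].
  exists set0; rewrite big1 // => d gd; have : d \in [set d | g d == w] by rewrite inE.
  by rewrite E inE.
exists (gclass (v d)); rewrite big1 // => d' gd'.
have /card_le1_eqP inj : #|[set d | g d == w]| <= 1 by [].
have -> : d' = d by apply: inj; rewrite // inE.
by rewrite eqxx.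
Qed.

(** Darts are the edges of a bipartite graph between terminals and groups. If there were [c >= 2]
    classes, each class cut would have at least [3 * m] darts, but all cuts together have at most
    [3 * (m * (c - 1))]. *)
Lemma glued_total : 0 < m ->
  (forall (X : {set T}) (Y : {set W}), X != set0 -> X != setT ->
     3 * m <= #|[set d | (v d \in X) != (g d \in Y)]|) ->
  forall x y, glued x y.
Proof.
move=> m0 cut x y; apply/negPn/negP => nxy.
have [h hP] := choice group_assignment.
have in_gc U z : U \in gclasses -> (z \in U) = (gclass z == U).
  by case/imsetP => u _ ->; rewrite inE gclass_eq glued_sym.
have lower U : U \in gclasses ->
    3 * m <= \sum_d ((gclass (v d) == U) != (h (g d) == U)).
  move=> UC; apply: leq_trans (cut U [set w | h w == U] _ _) _.
  - by apply: contraTneq UC => ->; exact: set0_gclass.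
  - apply: contraNneq nxy => UT; have := in_gc U x UC; have := in_gc U y UC.
    by rewrite UT !inE => /esym/eqP ey /esym/eqP ex; rewrite -gclass_eq ex ey.
  - rewrite -sum1_card big_mkcond /=; apply: leq_sum => d _.
    by rewrite !inE (in_gc U) //; case: (_ != _).
(* A dart whose group lies elsewhere is in the cut of its own class and, if [h (g d)] is a class, in
   that cut too. *)
have upper d : \sum_(U in gclasses) ((gclass (v d) == U) != (h (g d) == U)) <=
    (gclass (v d) != h (g d)) * (1 + (h (g d) \in gclasses)).
  have [->|ne] := eqVneq (gclass (v d)) (h (g d)).
    by rewrite big1 // => U _; rewrite eqxx.
  rewrite mul1n; apply: leq_trans (_ : \sum_(U in gclasses)
    ((gclass (v d) == U) + (h (g d) == U)) <= _).
    by apply: leq_sum => U _; case: (gclass (v d) == U); case: (h (g d) == U).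
  rewrite big_split /=; apply: leq_add.
    rewrite (bigD1 (gclass (v d))) ?imset_f //= eqxx big1 ?addn0 //.
    by move=> U /andP[_]; rewrite eq_sym => /negPf ->.
  have [hC|hC] := boolP (_ \in _).
    rewrite (bigD1 (h (g d))) //= eqxx big1 ?addn0 //.
    by move=> U /andP[_]; rewrite eq_sym => /negPf ->.
  by rewrite big1 // => U UC; case: eqP => // hU; rewrite hU UC in hC.
have : \sum_(U in gclasses) 3 * m <= 3 * (m * #|gclasses|.-1).
  apply: leq_trans (leq_sum _ lower) _; rewrite exchange_big /=.
  apply: leq_trans (leq_sum _ (fun d _ => upper d)) _.
  rewrite (partition_big g predT) //=.
  apply: leq_trans (_ : \sum_w 3 * #|outer w| <= _).
    apply: leq_sum => w _; apply: leq_trans (hP w); apply/eq_leq/eq_bigr.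
    by move=> d /eqP ->.
  by rewrite -big_distrr leq_mul2l /=; exact: outer_sum.
rewrite sum_nat_const.
have : 0 < #|gclasses| by apply/card_gt0P; exists (gclass x); exact: imset_f.
case: #|_| => // c _ /=; nia.
Qed.

End Packing.

Arguments src {T D} v {m} a.
Arguments tgt {T D} v {m} a.

(* A form of the theorem of Frank, Kiraly and Kriesell on packing Steiner trees when the
   non-terminal vertices are independent. *)
Theorem packing_exists (T D W : finType) (v : D -> T) (g : D -> W) (m : nat) : 0 < m ->
  (forall (X : {set T}) (Y : {set W}), X != set0 -> X != setT ->
     3 * m <= #|[set d | (v d \in X) != (g d \in Y)]|) ->
  exists A : {set D * D * 'I_m},
    packing g A /\ forall l x y, econn (src v) (tgt v) (col A l) x y.
Proof.
move=> m0 cut; have [A0 sat] := saturated_exists v g m; exists A0.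
split=> [|l x y]; first by case: sat.
have := glued_total sat m0 cut x y; rewrite (glued_inn sat l).
by apply: econn_mono; apply/subsetP => a; rewrite !inE => /andP[].
Qed.

Lemma card_bigcup_leq (T J : finType) (P : pred J) (F : J -> {set T}) :
  #|\bigcup_(j | P j) F j| <= \sum_(j | P j) #|F j|.
Proof.
elim/big_rec2: _ => [|j n B _ le]; first by rewrite cards0.
by apply: leq_trans (leq_card_setU _ _) _; rewrite leq_add2l.
Qed.

(** * Combs in connected sets of bounded degree *)

Section Combs.
Variables (T : finType) (e : rel T).
Hypothesis (e_sym : symmetric e).
Implicit Types (S A C Y : {set T}) (x y z : T).

Definition within S : rel T := connect [rel a b | [&& e a b, a \in S & b \in S]].

Lemma within_sym S : symmetric (within S).
Proof.
by apply: sym_connect_sym => x y /=; rewrite e_sym [(x \in S) && _]andbC.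
Qed.

Lemma within_mono S C x y : S \subset C -> within S x y -> within C x y.
Proof.
move=> /subsetP SC; apply: connect_sub => a b /and3P[ab /SC aC /SC bC].
by apply: connect1; rewrite /= ab aC.
Qed.

Lemma within_edge S x y : x \in S -> y \in S -> e x y -> within S x y.
Proof. by move=> xS yS xy; apply: connect1; rewrite /= xy xS. Qed.

Lemma within_mem S x y : within S x y -> x \in S -> y \in S.
Proof.
move=> /connectP[s]; elim: s x => [|z s IHs] x /= ; first by move=> _ ->.
by case/andP=> /and3P[_ _ zS] /IHs/[apply] h _; exact: h.
Qed.

Lemma connected_within S x : (forall y, y \in S -> within S x y) -> connected_in e S.
Proof.
move=> h y z /h xy /h; apply: connect_trans; move: xy.
by rewrite -!/(within S _ _) within_sym.
Qed.

Lemma connected_setU S C x y : connected_in e S -> connected_in e C ->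
  x \in S -> y \in C -> e x y -> connected_in e (S :|: C).
Proof.
move=> cS cC xS yC xy; apply: (@connected_within _ x) => z /setUP[zS|zC].
  by apply: within_mono (cS _ _ xS zS); exact: subsetUl.
apply: (@connect_trans _ _ y); last first.
  by apply: within_mono (cC _ _ yC zC); exact: subsetUr.
by apply: within_edge; rewrite // inE ?xS ?yC ?orbT.
Qed.

Definition branch A x y := [set z | within (A :\ x) y z].

Lemma branch_sub A x y : y \in A :\ x -> branch A x y \subset A :\ x.
Proof. by move=> yA; apply/subsetP => z; rewrite inE => /within_mem; exact. Qed.

Lemma branch_connected A x y : y \in A :\ x -> connected_in e (branch A x y).
Proof.
move=> yA; apply: (@connected_within _ y) => z; rewrite inE => /connectP[s sP ->].
elim/last_ind: s sP => [|s u IHs]; first by move=> _; exact: connect0.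
rewrite rcons_path last_rcons => /andP[sP lu]; apply: connect_trans (IHs sP) _.
case/and3P: lu => lu l1 u1; have ly : within (A :\ x) y (last y s) by apply/connectP; exists s.
apply: within_edge => //; rewrite inE //; apply: connect_trans ly _.
exact: within_edge.
Qed.

Lemma branch_first A x z : connected_in e A -> x \in A -> z \in A :\ x ->
  exists y, [/\ y \in A :\ x, e x y & z \in branch A x y].
Proof.
move=> cA xA; rewrite inE => /andP[/= zx zA]; have /connectP[s sP zE] := cA x z xA zA.
case/shortenP: sP zE => {}s sP us _ zE.
case: s sP us zE => [_ _ zE|y s /= /andP[/and3P[xy _ yA] sP] /andP[xs us] zE].
  by rewrite zE /= inE eqxx in zx.
have yx : y != x by apply: contraNneq xs => ->; rewrite mem_head.
exists y; split=> //; first by rewrite !inE yx.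
rewrite inE zE; apply/connectP; exists s => //.
move: xs; rewrite inE negb_or => /andP[_ xs].
elim: s y {us zE xy} yx yA sP xs => //= u s IHs y yx yA /andP[/and3P[yu _ uA] sP].
rewrite inE negb_or => /andP[xu xs]; rewrite eq_sym in xu.
by rewrite yu !inE yx yA xu uA /= IHs.
Qed.

(** Every other branch is attached to [x] by an edge of its own. *)
Lemma branch_rest A x y : connected_in e A -> x \in A -> y \in A :\ x ->
  connected_in e (A :\: branch A x y).
Proof.
move=> cA xA yA; set C := branch A x y.
have xC : x \notin C by apply/negP => /(subsetP (branch_sub yA)); rewrite !inE eqxx.
apply: (@connected_within _ x) => z; rewrite inE => /andP[zC zA].
have [->|zx] := eqVneq z x; first exact: connect0.
have [|u [uA xu zu]] := branch_first cA xA (z := z); first by rewrite !inE zx.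
have sub : branch A x u \subset A :\: C.
  apply/subsetP => a au; have aA := subsetP (branch_sub uA) a au.
  rewrite inE; move: aA; rewrite !inE => /andP[_ ->]; rewrite andbT.
  apply: contra zC; rewrite /C !inE => ya; apply: connect_trans ya _.
  rewrite !inE in au zu; apply: connect_trans zu; move: au.
  by rewrite -!/(within _ _ _) within_sym.
have uu : u \in branch A x u by rewrite inE; exact: connect0.
apply: (@connect_trans _ _ u).
  by apply: within_edge xu; [rewrite inE xC | exact: subsetP sub _ _].
exact: within_mono sub (branch_connected uA uu zu).
Qed.

Fixpoint comb_bound (D s : nat) := if s is s'.+1 then (D * comb_bound D s').+2 else 0.

(** [S a] is a tooth together with its stretch of the spine, so any interval of consecutive pieces
    has a connected union. *)
Definition comb A Y s (S : nat -> {set T}) (y : nat -> T) :=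
  [/\ forall a, a < s -> [/\ S a \subset A, connected_in e (S a), y a \in S a & y a \in Y],
      forall a b, a < b < s -> [disjoint S a & S b] &
      forall a, a.+1 < s -> exists u z, [/\ u \in S a, z \in S a.+1 & e u z]].

(* Walk into the branch with most marks; whenever a mark is left behind, what is
   left behind becomes the first tooth. *)
Lemma comb_exists D s A Y x : (forall z, #|[set u | e z u]| <= D) ->
  connected_in e A -> x \in A -> comb_bound D s <= #|A :&: Y| ->
  exists (S : nat -> {set T}) (y : nat -> T), comb A Y s S y /\ (0 < s -> x \in S 0).
Proof.
move=> degD; elim: s A x => [|s IHs] A x.
  move=> _ _ _; exists (fun=> set0), (fun=> x); split=> //.
  by split=> [a|a b|a]; rewrite ?ltn0 ?andbF.
(* The inner induction on [#|A|] covers the moves that leave no mark behind and so yield no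
   tooth. *)
elim: {A}_.+1 {-2}A x (ltnSn #|A|) => // n IHn A x ltA cA xA.
case: s IHs IHn => [|s] IHs IHn bnd.
  have /card_gt0P[y] : 0 < #|A :&: Y| by apply: leq_trans bnd.
  rewrite inE => /andP[yA yY]; exists (fun=> A), (fun=> y); split=> //.
  by split=> [a|a b|a] //; lia.
set N := comb_bound D s.+1 in IHs.
(* Otherwise [x] and its at most [D] branches carry at most [1 + D * N.-1] marks, fewer than the
   [D * N + 2] of [comb_bound]. *)
have [u [uA xu leN]] : exists u, [/\ u \in A :\ x, e x u & N <= #|branch A x u :&: Y|].
  have [/exists_inP[u uA /andP[xu leN]]|/exists_inPn no] :=
    boolP [exists u in A :\ x, e x u && (N <= #|branch A x u :&: Y|)]; first by exists u.
  have: #|A :&: Y| <= 1 + \sum_(u in [set u in A :\ x | e x u]) #|branch A x u :&: Y|.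
    apply: leq_trans (_ : #|x |: \bigcup_(u in [set u in A :\ x | e x u])
       (branch A x u :&: Y)| <= _).
      apply: subset_leq_card; apply/subsetP => z /setIP[zA zY].
      have [->|zx] := eqVneq z x; first by rewrite setU11.
      have [|w [wA xw zw]] := branch_first cA xA (z := z); first by rewrite !inE zx.
      apply/setU1P; right; apply/bigcupP; exists w; last by apply/setIP.
      by rewrite inE wA.
    by apply: leq_trans (leq_card_setU _ _) _; rewrite cards1 leq_add2l card_bigcup_leq.
  move: bnd; rewrite /= -/N => bnd le; exfalso.
  have: \sum_(u in [set u in A :\ x | e x u]) #|branch A x u :&: Y| <= D * N.-1.
    apply: leq_trans (_ : \sum_(u in [set u in A :\ x | e x u]) N.-1 <= _).
      apply: leq_sum => w; rewrite inE => /andP[/no + xw]; rewrite xw /=.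
      by rewrite -ltnNge => lt; rewrite -ltnS (ltn_predK lt).
    rewrite sum_nat_const leq_mul2r; apply/orP; right.
    apply: leq_trans (degD x); apply: subset_leq_card; apply/subsetP => w.
    by rewrite !inE => /andP[].
  rewrite leqNgt => /negP; apply; rewrite -(leq_add2l 1); apply: leq_trans le.
  by apply: leq_trans bnd; rewrite add1n !ltnS leq_mul2l leq_pred orbT.
have cC := branch_connected uA; have sC := branch_sub uA.
have uC : u \in branch A x u by rewrite inE; exact: connect0.
set C := branch A x u in cC sC uC leN.
have CA : C \subset A by apply: subset_trans sC (subsetDl _ _).
have xC : x \notin C by apply/negP => /(subsetP sC); rewrite !inE eqxx.
(* If no mark is left behind, only [x] is kept: it joins the first piece of the comb in [C], which
   contains [u]. *)
have [E|[y yD]] := set_0Vmem ((A :\: C) :&: Y).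
  have eCA : C :&: Y = A :&: Y.
    apply/eqP; rewrite eqEsubset setSI //; apply/subsetP => z /setIP[zA zY].
    rewrite in_setI zY andbT; apply/negPn/negP => zC.
    have : z \in set0 by rewrite -E in_setI in_setD zC zA.
    by rewrite in_set0.
  have ltC : #|C| < n.
    apply: leq_trans (proper_card _) (_ : #|A| <= n) => //.
    by apply/properP; split=> //; exists x.
  rewrite -eCA in bnd; have [S [y [[c1 c2 c3] /(_ isT) uS]]] := IHn C u ltC cC uC bnd.
  exists (fun a => if a is 0 then x |: S 0 else S a), y; split=> [|_]; last exact: setU11.
  have S0C : S 0 \subset C by have [] := c1 0 isT.
  split.
  - case=> [_|a lta]; last by have [h1 h2 h3 h4] := c1 _ lta; split=> //; exact: subset_trans CA.
    have [h1 h2 h3 h4] := c1 0 isT; split=> //; last by rewrite inE h3 orbT.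
      by rewrite subUset sub1set xA (subset_trans h1 CA).
    apply: (connected_setU (x := x) (y := u)); rewrite ?set11 // => a b.
    by move=> /set1P-> /set1P->; exact: connect0.
  - case=> [|a] [|b] //= ltb; last by apply: c2.
    rewrite disjoints_subset subUset sub1set in_setC -disjoints_subset (c2 0 b.+1) // andbT; apply: contra xC; apply/subsetP.
    by have [] := c1 b.+1 ltb.
  - case=> [|a] lta; last exact: c3.
    by have [w [z [w1 z1 wz]]] := c3 0 lta; exists w, z; rewrite inE w1 orbT.
have [S [y' [[c1 c2 c3] /(_ isT) uS]]] := IHs C u cC uC leN.
exists (fun a => if a is a'.+1 then S a' else A :\: C), (fun a => if a is a'.+1 then y' a' else y).
split=> [|_]; last by rewrite inE xC.
split.
- case=> [_|a lta]; last by have [h1 h2 h3 h4] := c1 _ lta; split=> //; exact: subset_trans CA.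
  move: yD; rewrite inE => /andP[yD yY]; split=> //; first exact: subsetDl.
  exact: branch_rest.
- case=> [|a] [|b] //= ltb; last by apply: c2.
  have [h1 _ _ _] := c1 b ltb; rewrite disjoint_sym; apply: disjointWl h1 _.
  by rewrite disjoints_subset setCD subsetUr.
- case=> [|a] lta; last exact: c3.
  by exists x, u; rewrite inE xC xA.
Qed.

End Combs.

(** * Points in a common order along several combs *)

(** The exponential bound permits a direct induction: the head precedes either the indices of larger
    value or those of smaller value, and one of these families retains [2 ^ (a + b - 1)] indices. *)
Lemma monotone_subseq (sigma : nat -> nat) a b (s : seq nat) :
  uniq s -> {in s &, injective sigma} -> 2 ^ (a + b) <= size s ->
  exists s', subseq s' s /\
   (size s' = a /\ pairwise (fun i j => sigma i < sigma j) s' \/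
    size s' = b /\ pairwise (fun i j => sigma j < sigma i) s').
Proof.
move E : (a + b) => n; elim: n a b E s => [|n IHn] a b abn s us inj le.
  by exists [::]; split; [exact: sub0seq | left; split=> //=; lia].
case: a abn => [|a] abn; first by exists [::]; split; [exact: sub0seq | left].
case: b abn => [|b] abn; first by exists [::]; split; [exact: sub0seq | right].
case: s us inj le => [|h s] /= us inj le.
  by move: le; rewrite leqn0 expn_eq0.
case/andP: us => hs us.
have injs : {in s &, injective sigma}.
  by move=> x y xs ys; apply: inj; rewrite inE ?xs ?ys orbT.
have filt (P : pred nat) : uniq (filter P s) /\ {in filter P s &, injective sigma}.
  split; first exact: filter_uniq.
  by move=> x y; rewrite !mem_filter => /andP[_ xs] /andP[_ ys]; exact: injs.
have sz : size (filter (fun i => sigma h < sigma i) s) +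
          size (filter (fun i => sigma i < sigma h) s) = size s.
  rewrite -[RHS](count_predC (fun i => sigma h < sigma i)) !size_filter; congr (_ + _).
  apply: eq_in_count => i ins /=; rewrite -leqNgt ltn_neqAle andb_idl // => _.
  apply: contraNneq hs => /inj <- //; rewrite inE ?eqxx // ins orbT //.
have [big1|small1] := leqP (2 ^ n) (size (filter (fun i => sigma h < sigma i) s)).
  have [u1 i1] := filt (fun i => sigma h < sigma i).
  have [|s' [ss' [[sz' pw]|[sz' pw]]]] := IHn a b.+1 _ _ u1 i1 big1; first by lia.
    exists (h :: s'); split; first by rewrite /= eqxx (subseq_trans ss') ?filter_subseq.
    left; rewrite /= sz' pw andbT; split=> //; apply/allP => x /(mem_subseq ss').
    by rewrite mem_filter => /andP[].
  exists s'; split; last by right.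
  by apply: subseq_trans ss' (subseq_trans (filter_subseq _ _) (subseq_cons _ _)).
have big2 : 2 ^ n <= size (filter (fun i => sigma i < sigma h) s).
  by move: le; rewrite expnS; lia.
have [u1 i1] := filt (fun i => sigma i < sigma h).
have [|s' [ss' [[sz' pw]|[sz' pw]]]] := IHn a.+1 b _ _ u1 i1 big2; first by lia.
  exists s'; split; last by left.
  by apply: subseq_trans ss' (subseq_trans (filter_subseq _ _) (subseq_cons _ _)).
exists (h :: s'); split; first by rewrite /= eqxx (subseq_trans ss') ?filter_subseq.
right; rewrite /= sz' pw andbT; split=> //; apply/allP => x /(mem_subseq ss').
by rewrite mem_filter => /andP[].
Qed.

Section Linked.
Variables (T : finType) (e : rel T) (X : Type).
Hypothesis e_sym : symmetric e.
Implicit Types (F : {set T}) (f : X -> T) (xs : nat -> X).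

(** Only the order of the points matters here, so this property passes to subsequences and
    reversals. *)
Definition segments n F f xs (C : nat -> nat -> {set T}) :=
  (forall a b, a <= b < n -> [/\ C a b \subset F, connected_in e (C a b),
     f (xs a) \in C a b & f (xs b) \in C a b]) /\
  (forall a b a' b', a <= b < a' -> a' <= b' < n -> [disjoint C a b & C a' b']).

Definition linked n F f xs := exists C, segments n F f xs C.

Lemma linked_sub n n' F f xs xs' (phi : nat -> nat) :
  (forall a, a < n' -> phi a < n /\ xs' a = xs (phi a)) ->
  (forall a b, a < b < n' -> phi a < phi b) ->
  linked n F f xs -> linked n' F f xs'.
Proof.
move=> phiP mono [C [c1 c2]]; exists (fun a b => C (phi a) (phi b)).
have le a b : a <= b < n' -> phi a <= phi b.
  by case/andP; rewrite leq_eqVlt => /orP[/eqP->//|ab bn]; apply/ltnW/mono/andP.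
split=> [a b abn|a b a' b' aba abn].
  have [ltb xb] : phi b < n /\ xs' b = xs (phi b) by apply: phiP; lia.
  have [lta xa] : phi a < n /\ xs' a = xs (phi a) by apply: phiP; lia.
  by rewrite xa xb; apply: c1; rewrite le.
have [ltb _] : phi b' < n /\ xs' b' = xs (phi b') by apply: phiP; lia.
by apply: c2; rewrite ?le ?mono ?ltb //=; lia.
Qed.

Lemma linked_rev n F f xs xs' : (forall a, a < n -> xs' a = xs (n.-1 - a)) ->
  linked n F f xs -> linked n F f xs'.
Proof.
move=> xsE [C [c1 c2]]; exists (fun a b => C (n.-1 - b) (n.-1 - a)).
split=> [a b abn|a b a' b' aba abn].
  by rewrite !xsE; try lia; have [|? ? ? ?] := c1 (n.-1 - b) (n.-1 - a); [lia | split].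
by rewrite disjoint_sym; apply: c2; lia.
Qed.

Lemma comb_linked F (Y : {set T}) n (S : nat -> {set T}) y f xs :
  comb e F Y n S y -> (forall a, a < n -> f (xs a) = y a) -> linked n F f xs.
Proof.
move=> [c1 c2 c3] fy; exists (fun a b => \bigcup_(c < n | a <= c <= b) S c).
have sub a b c : a <= c <= b -> c < n -> S c \subset \bigcup_(c < n | a <= c <= b) S c.
  by move=> acb cn; apply: (@bigcup_sup _ _ (Ordinal cn)).
split=> [a b abn|a b a' b' aba abn].
- have mem c : a <= c <= b -> f (xs c) \in \bigcup_(c < n | a <= c <= b) S c.
    move=> acb; have cn : c < n by lia.
    by rewrite fy //; have [_ _ yS _] := c1 c cn; apply: subsetP (sub a b c acb cn) _ yS.
  split; [ | | by apply: mem; lia | by apply: mem; lia].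
    by apply/bigcupsP => c _; have [] := c1 c (ltn_ord c).
  elim: b abn {mem} => [|b IHb] abn.
    have -> : \bigcup_(c < n | a <= c <= 0) S c = S 0.
      have n0 : 0 < n by lia.
      rewrite (bigD1 (Ordinal n0)) /=; last by lia.
      rewrite big1 ?setU0 // => c /andP[h1 /eqP h2]; case: h2; apply: val_inj => /=; lia.
    by have [] := c1 0 ltac:(lia).
  have bn : b.+1 < n by lia.
  have [eab|ltab] := eqVneq a b.+1.
    rewrite (bigD1 (Ordinal bn)) /=; last by lia.
    rewrite big1 ?setU0; first by have [] := c1 _ bn.
    by move=> c /andP[h1 /eqP h2]; case: h2; apply: val_inj => /=; lia.
  have -> : \bigcup_(c < n | a <= c <= b.+1) S c =
            \bigcup_(c < n | a <= c <= b) S c :|: S b.+1.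
    rewrite (bigD1 (Ordinal bn)) /=; last by lia.
    rewrite setUC; congr (_ :|: _); apply: eq_bigl => c.
    by rewrite -(inj_eq val_inj) /=; lia.
  have [u [z [uS zS uz]]] := c3 b bn.
  apply: (connected_setU e_sym _ _ _ zS uz); first by apply: IHb; lia.
    by have [] := c1 _ bn.
  by apply: subsetP uS; apply: sub; lia.
- rewrite disjoints_subset; apply/bigcupsP => c hc; rewrite -disjoints_subset disjoint_sym.
  rewrite disjoints_subset; apply/bigcupsP => c' hc'; rewrite -disjoints_subset.
  by rewrite disjoint_sym; apply: c2; have := ltn_ord c'; lia.
Qed.

End Linked.

(** Induction on [m]: the points found for the first [m] subgraphs are thinned along a comb of the
    last one, whose teeth meet them in the order [sigma]. *)
Lemma linked_exists m n D : exists N, forall (T : finType) (e : rel T) (X : finType)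
    (F : nat -> {set T}) (f : nat -> X -> T),
  symmetric e -> (forall z, #|[set u | e z u]| <= D) ->
  (forall l, l < m -> connected_in e (F l)) ->
  (forall l x, l < m -> f l x \in F l) ->
  (forall l y, l < m -> #|[set x | f l x == y]| <= 2) ->
  N <= #|X| ->
  exists xs : nat -> X, (forall a b, a < b < n -> xs a != xs b) /\
    forall l, l < m -> linked e n (F l) (f l) xs.
Proof.
elim: m n => [|m IHm] n.
  exists n.+1 => T e X F f _ _ _ _ _ le.
  have /card_gt0P[x0 _] : 0 < #|X| by apply: leq_trans le.
  exists (nth x0 (enum X)); split=> // a b /andP[ab bn].
  have bX : b < #|X| by apply: leq_trans le; exact: ltnW.
  by rewrite nth_uniq ?enum_uniq -?cardE ?(ltn_eqF ab) //; exact: ltn_trans bX.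
have [s s2E] : exists s, s = 2 ^ (n + n) by exists (2 ^ (n + n)).
have [k kE] : exists k, k = comb_bound D s by exists (comb_bound D s).
(* Since [f m] is at most two-to-one, [2 * k + 1] points give at least [k] marks. *)
have [n1 n1E] : exists n1, n1 = (2 * k).+1 by exists (2 * k).+1.
have [N NP] := IHm n1.
exists N => T e X F f es deg cF fF fib le.
have [zs [zinj zl]] := NP T e X F f es deg (fun l lm => cF l (ltnW lm))
  (fun l x lm => fF l x (ltnW lm)) (fun l y lm => fib l y (ltnW lm)) le.
have lm := ltnSn m.
pose g (i : 'I_n1) := f m (zs i); pose Y := [set g i | i : 'I_n1].
have leY : k <= #|Y|.
  suff : n1 <= 2 * #|Y| by rewrite n1E => /ltnW; rewrite leq_pmul2l.
  have -> : n1 = \sum_(i < n1) 1 by rewrite sum1_card card_ord.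
  rewrite (partition_big g (mem Y)) /=; last first.
    by move=> i _; exact: imset_f.
  rewrite mulnC -sum_nat_const.
  apply: leq_sum => y _; apply: leq_trans (fib m y lm).
  rewrite sum1_card -(card_imset (f := fun i : 'I_n1 => zs i)) => [|i j].
    apply: subset_leq_card; apply/subsetP => x /imsetP[i iy ->].
    by rewrite inE; exact: iy.
  move=> zE; apply: val_inj => /=; have [ij|ij|//] := ltngtP (i : nat) j.
    by have := zinj i j; rewrite ij ltn_ord zE eqxx; case/(_ isT).
  by have := zinj j i; rewrite ij ltn_ord zE eqxx; case/(_ isT).
have YF : F m :&: Y = Y.
  by apply/setIidPr/subsetP => y /imsetP[i _ ->]; exact: fF.
have [|S [y [cS _]]] := @comb_exists T e es D s (F m) Y (f m (zs 0)) deg (cF m lm) (fF _ _ lm).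
  by rewrite YF -kE.
have [c1 c2 _] := cS.
have /choice[sigma sP] a : exists i, a < s -> i < n1 /\ f m (zs i) = y a.
  have [lta|_] := ltnP a s; last by exists 0.
  have [_ _ _ /imsetP[i _ yE]] := c1 a lta; exists i => _; split; first exact: ltn_ord.
  by rewrite yE.
have sinj : {in iota 0 s &, injective sigma}.
  have lts a b : a < b < s -> sigma a != sigma b.
    case/andP=> ab bs; have as_ := ltn_trans ab bs; apply/eqP => sE.
    have := c2 a b; rewrite ab bs => /(_ isT); have [_ _ ya _] := c1 a as_.
    have [_ _ yb _] := c1 b bs; move=> /disjointFr/(_ ya).
    by rewrite -(sP a as_).2 sE (sP b bs).2 yb.
  move=> a b; rewrite !mem_iota !add0n /= => as_ bs sE.
  have [ab|ab|//] := ltngtP a b.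
    by have := lts a b; rewrite ab bs sE eqxx => /(_ isT).
  by have := lts b a; rewrite ab as_ sE eqxx => /(_ isT).
have [|s' [ss' alt]] := monotone_subseq (a := n) (b := n) (iota_uniq 0 s) sinj.
  by rewrite size_iota s2E.
have szs' : size s' = n by case: alt => -[].
pose psi := nth 0 s'.
have psi_s a : a < n -> psi a < s.
  move=> an; have : psi a \in iota 0 s by apply: (mem_subseq ss'); rewrite mem_nth ?szs'.
  by rewrite mem_iota.
have psi_mono a b : a < b < n -> psi a < psi b.
  have : pairwise ltn s' by apply: subseq_pairwise ss' _; rewrite -sorted_pairwise ?iota_ltn_sorted //; exact: ltn_trans.
  by move=> /(pairwiseP 0) h /andP[ab bn]; apply: h; rewrite // inE szs' //; exact: ltn_trans bn.
have lm_psi : linked e n (F m) (f m) (zs \o sigma \o psi).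
  apply: (linked_sub (n := s) (phi := psi) (xs := zs \o sigma)) psi_mono _.
    by move=> a an; split; first exact: psi_s.
  by apply: (comb_linked es cS) => a lta; exact: (sP a lta).2.
have sig_lt a : a < n -> sigma (psi a) < n1 by move=> an; exact: (sP _ (psi_s _ an)).1.
exists (zs \o sigma \o psi); case: alt => -[_ /(pairwiseP 0) pw].
  have mono a b : a < b < n -> sigma (psi a) < sigma (psi b).
    by case/andP=> ab bn; apply: pw; rewrite // inE szs' //; exact: ltn_trans bn.
  split=> [a b abn|l].
    by apply: zinj; rewrite mono //= sig_lt //; case/andP: abn.
  rewrite ltnS leq_eqVlt => /orP[/eqP->//|/zl].
  by apply: (linked_sub (phi := sigma \o psi)) mono => a an; split; first exact: sig_lt.
(* In the decreasing case the new points run backwards along the earlier subgraphs, so the segments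
   of these are reversed. *)
have mono a b : a < b < n -> sigma (psi b) < sigma (psi a).
  by case/andP=> ab bn; apply: pw; rewrite // inE szs' //; exact: ltn_trans bn.
split=> [a b abn|l].
  by rewrite eq_sym; apply: zinj; rewrite mono //= sig_lt //; lia.
rewrite ltnS leq_eqVlt => /orP[/eqP->//|/zl zll].
apply: (linked_rev (xs := fun a => zs (sigma (psi (n.-1 - a))))) => [a an|].
  by rewrite subKn //=; lia.
apply: (linked_sub (phi := fun a => sigma (psi (n.-1 - a)))) zll => [a an|a b abn].
  by split=> //; apply: sig_lt; lia.
by apply: mono; lia.
Qed.

(** * The branch sets for the thick cycle *)

Lemma val_ordS n (i : 'I_n) : ordS i = (if i.+1 < n then i.+1 else 0) :> nat.
Proof.
rewrite /=; case: ltnP => [/modn_small //|le].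
have -> : i.+1 = n by apply/eqP; rewrite eqn_leq le ltn_ord.
exact: modnn.
Qed.

(* The cycle is closed by the segment from the last marked point back to the first one,
   so every column j uses three colours: two alternating ones for the short segments. *)
Lemma ring_minor r t (T : finType) (e : rel T) (X : Type) (F : nat -> {set T})
    (f : nat -> X -> T) (xs : nat -> X) :
  (forall l l', l < 3 * t -> l' < 3 * t -> l != l' -> [disjoint F l & F l']) ->
  (forall l l' x, l < 3 * t -> l' < 3 * t -> l != l' -> e (f l x) (f l' x)) ->
  (forall l, l < 3 * t -> linked e r (F l) (f l) xs) ->
  is_minor (line_adj (@Ctr_ends t r)) e.
Proof.
move=> dF adj lnk.
have /choice[C CP] l : exists C, l < 3 * t -> segments e r (F l) (f l) xs C.
  by have [/lnk[C CP]|_] := ltnP l (3 * t); [exists C | exists (fun _ _ => set0)].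
pose last_ (u : 'I_r * 'I_t) := ~~ (u.1.+1 < r).
pose lo (u : 'I_r * 'I_t) : nat := if last_ u then 0 else u.1.
pose hi (u : 'I_r * 'I_t) : nat := if last_ u then u.1 : nat else u.1.+1.
pose cl (u : 'I_r * 'I_t) : nat := 3 * u.2 + (if last_ u then 2 else odd u.1).
have cl_lt u : cl u < 3 * t.
  by rewrite /cl; have := ltn_ord u.2; case: (last_ u); case: (odd u.1); lia.
have lohi u : lo u <= hi u < r.
  by rewrite /lo /hi /last_; have := ltn_ord u.1; case: (ltnP u.1.+1 r) => /=; lia.
(* Two edges of one copy with the same colour have equal parity and neither closes the cycle, so
   their segments share no point. *)
have aux (a b : nat) : a < r -> b < r -> a <> b ->
    (if ~~ (a.+1 < r) then 2 else odd a) = (if ~~ (b.+1 < r) then 2 else odd b) :> nat ->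
    [/\ ~~ ~~ (a.+1 < r), ~~ ~~ (b.+1 < r) & (a.+1 < b) || (b.+1 < a)].
  case: (ltnP a.+1 r); case: (ltnP b.+1 r) => /=; case: (odd a) (odd_double_half a);
    case: (odd b) (odd_double_half b) => /= *; split=> //; lia.
have clE (u w : 'I_r * 'I_t) : u != w -> cl u = cl w ->
    [/\ ~~ last_ u, ~~ last_ w & (u.1.+1 < w.1) || (w.1.+1 < u.1)].
  move=> uw; rewrite /cl => E.
  have e2 : u.2 = w.2.
    by apply: val_inj => /=; move: E; case: (last_ u); case: (last_ w);
       case: (odd u.1); case: (odd w.1); lia.
  have n1 : (u.1 : nat) <> w.1.
    by move=> e1; case/eqP: uw; case: u w e2 e1 {E} => [a b] [a' b'] /= -> /val_inj ->.
  by move: E; rewrite e2 => /addnI; apply: aux.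
have dis (u w : 'I_r * 'I_t) : u.1.+1 < w.1 -> ~~ last_ u -> ~~ last_ w -> cl u = cl w ->
    [disjoint C (cl u) (lo u) (hi u) & C (cl w) (lo w) (hi w)].
  move=> ltuw nu nw E; have [_ c2] := CP _ (cl_lt u); rewrite -E; apply: c2.
    by rewrite /lo /hi (negPf nu) (negPf nw); lia.
  exact: lohi.
exists (fun u => C (cl u) (lo u) (hi u)); split.
- move=> u; have [c1 _] := CP _ (cl_lt u); have [_ _ h _] := c1 _ _ (lohi u).
  by apply/set0Pn; exists (f (cl u) (xs (lo u))).
- by move=> u; have [c1 _] := CP _ (cl_lt u); have [_ h _ _] := c1 _ _ (lohi u).
- move=> u w uw; have [E|nE] := eqVneq (cl u) (cl w); last first.
    have [c1 _] := CP _ (cl_lt u); have [s1 _ _ _] := c1 _ _ (lohi u).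
    have [c2 _] := CP _ (cl_lt w); have [s2 _ _ _] := c2 _ _ (lohi w).
    by apply: disjointW s1 s2 _; exact: dF.
  have [nu nw /orP[lt|lt]] := clE u w uw E; first exact: dis.
  by rewrite disjoint_sym; exact: dis.
- move=> u w /andP[uw /= sh].
  have mem (z : 'I_r * 'I_t) a : (a = lo z \/ a = hi z) -> f (cl z) (xs a) \in C (cl z) (lo z) (hi z).
    have [c1 _] := CP _ (cl_lt z); have [_ _ h1 h2] := c1 _ _ (lohi z).
    by case=> ->.
  have ends1 (z : 'I_r * 'I_t) : (z.1 : nat) = lo z \/ (z.1 : nat) = hi z.
    by rewrite /lo /hi; case: (last_ z); [right | left].
  have ends2 (z : 'I_r * 'I_t) : (ordS z.1 : nat) = lo z \/ (ordS z.1 : nat) = hi z.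
    by rewrite /lo /hi /last_ val_ordS; case: ltnP; [right | left].
  have [a [au aw]] : exists a, (a = lo u \/ a = hi u) /\ (a = lo w \/ a = hi w).
    by case/or4P: sh => /eqP E; [exists u.1 | exists u.1 | exists (ordS u.1) | exists (ordS u.1)];
      split; rewrite ?E //; rewrite -?E //.
  exists (f (cl u) (xs a)), (f (cl w) (xs a)); split; [exact: mem | exact: mem |].
  (* Edges with a common end have different colours, so their branch sets contain adjacent
     representatives of [xs a]. *)
  apply: adj => //; apply/eqP => E; have [nu nw] := clE u w uw E.
  by move: au aw; rewrite /lo /hi (negPf nu) (negPf nw); lia.
Qed.

(** * Stars, cliques and degrees in line graphs *)

Section LineGraph.
Variables (V T : finType) (ends : T -> V * V).
Implicit Types (x y : T) (u w : V).

Definition incident u x := ((ends x).1 == u) || ((ends x).2 == u).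
Definition star u := [set x | incident u x].

Lemma line_adjP x y : reflect (x != y /\ exists u, incident u x /\ incident u y)
  (line_adj ends x y).
Proof.
apply: (iffP andP) => -[xy H]; split=> //.
  by case/or4P: H => /eqP E; [exists (ends x).1 | exists (ends x).1 |
    exists (ends x).2 | exists (ends x).2]; rewrite /incident E !eqxx ?orbT.
case: H => u [/orP[]/eqP<- /orP[]/eqP->]; by rewrite eqxx ?orbT.
Qed.

Lemma line_adj_sym : symmetric (line_adj ends).
Proof.
by move=> x y; apply/line_adjP/line_adjP => -[ne [u [h1 h2]]]; rewrite eq_sym; split=> //; exists u.
Qed.

Lemma clique_minor r t u : r * t <= #|star u| ->
  is_minor (line_adj (@Ctr_ends t r)) (line_adj ends).
Proof.
move=> le; have cE : #|{: 'I_r * 'I_t}| = r * t by rewrite card_prod !card_ord.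
have lt (a : 'I_r * 'I_t) : enum_rank a < #|star u|.
  by apply: leq_trans le; rewrite -cE.
pose h a := enum_val (Ordinal (lt a)).
have hinj : injective h.
  by move=> a b /enum_val_inj [] /val_inj /enum_rank_inj.
exists (fun a => [set h a]); split.
- by move=> a; apply/set0Pn; exists (h a); rewrite inE.
- by move=> a x y /set1P-> /set1P->; exact: connect0.
- by move=> a b ab; rewrite disjoints1 inE; apply: contra ab => /eqP/hinj ->.
- move=> a b /andP[ab _]; exists (h a), (h b); rewrite !inE; split=> //.
  apply/line_adjP; split; first by apply: contra ab => /eqP/hinj ->.
  by exists u; split; [have := enum_valP (Ordinal (lt a)) | have := enum_valP (Ordinal (lt b))];
    rewrite inE.
Qed.

Lemma line_degree D x : (forall u, #|star u| <= D) -> #|[set y | line_adj ends x y]| <= 2 * D.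
Proof.
move=> deg; apply: leq_trans (_ : #|star (ends x).1 :|: star (ends x).2| <= _).
  apply: subset_leq_card; apply/subsetP => y; rewrite !inE => /line_adjP[_ [u [ux uy]]].
  by case/orP: ux => /eqP ->; rewrite uy ?orbT.
by apply: leq_trans (leq_card_setU _ _) _; rewrite mul2n -addnn leq_add.
Qed.

(** Deleting the neighbours of [x] isolates it, so there are at least [k] of them; the summand 2
    counts [x] itself in both stars. *)
Lemma degree_sum k x : k_connected (line_adj ends) k ->
  k + 2 <= #|star (ends x).1| + #|star (ends x).2|.
Proof.
move=> [kT kc]; pose N := [set y | line_adj ends x y].
have kN : k <= #|N|.
  rewrite leqNgt; apply/negP => ltN.
  have [y] : exists y, y \notin x |: N.
    apply/existsP; rewrite -negb_forall; apply/negP => /forallP all_.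
    have : #|T| <= #|x |: N| by apply: subset_leq_card; apply/subsetP => y _; exact: all_.
    move/(leq_trans kT); rewrite cardsU1 ltnNge => /negP; apply.
    by apply: leq_trans ltN; rewrite -add1n leq_add2r leq_b1.
  rewrite in_setU1 negb_or => /andP[yx yN].
  have xN : x \in ~: N by rewrite !inE /line_adj eqxx.
  have := kc N ltN x y xN; rewrite in_setC => /(_ yN) /connectP[[|z s] /=].
    by move=> _ E; rewrite E eqxx in yx.
  by case/andP=> /and3P[xz _]; rewrite !inE xz.
have sub : N \subset (star (ends x).1 :\ x) :|: (star (ends x).2 :\ x).
  apply/subsetP => y; rewrite !inE => /line_adjP[xy [u [ux uy]]]; rewrite eq_sym xy /=.
  by case/orP: ux => /eqP ->; rewrite uy ?orbT.
have c1 : #|star (ends x).1| = 1 + #|star (ends x).1 :\ x|.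
  by rewrite (cardsD1 x) inE /incident eqxx.
have c2 : #|star (ends x).2| = 1 + #|star (ends x).2 :\ x|.
  by rewrite (cardsD1 x) inE /incident eqxx orbT.
have := leq_trans kN (leq_trans (subset_leq_card sub) (leq_card_setU _ _)).
rewrite c1 c2 => le; rewrite addnACA addn2 -add2n leq_add2l.
exact: le.
Qed.

End LineGraph.

(** * High vertices as terminals, and the cut condition for the packing *)

Section HighDegree.
Variables (V T : finType) (ends : T -> V * V) (k m : nat).
Hypothesis kc : k_connected (line_adj ends) k.
Hypothesis km : 6 * m < k + 4.
Hypothesis m0 : 0 < m.
Notation adj := (line_adj ends).
Notation inc := (incident ends).

Definition high u := 3 * m <= #|star ends u|.
Notation terminal := {u : V | high u}.

Definition dart_end (d : T * bool) := if d.2 then (ends d.1).1 else (ends d.1).2.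
Definition dart_opp (d : T * bool) := dart_end (d.1, ~~ d.2).
Notation dart := {d : T * bool | high (dart_end d)}.

Definition dart_terminal (d : dart) : terminal := exist _ (dart_end (val d)) (valP d).
Definition dart_group (d : dart) : T + V :=
  if high (dart_opp (val d)) then inl (val d).1 else inr (dart_opp (val d)).
Definition dart_edge (d : dart) : T := (val d).1.

(** Two low ends would have degree sum at most [6 * m - 2], which [km] makes smaller than
    [k + 2]. *)
Lemma high_end x : high (ends x).1 || high (ends x).2.
Proof.
have := degree_sum x kc; rewrite /high.
case: (leqP _ #|star ends (ends x).1|) => //= l1; case: (leqP (3 * m)) => //= l2.
by have := leq_add l1 l2; move: km; lia.
Qed.

Lemma dart_incident d : inc (val (dart_terminal d)) (dart_edge d).
Proof. by rewrite /incident /= /dart_end; case: (val d).2; rewrite eqxx ?orbT. Qed.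

Lemma dart_opp_incident d : inc (dart_opp (val d)) (dart_edge d).
Proof.
by rewrite /incident /dart_edge /dart_opp /dart_end /=; case: (val d).2; rewrite eqxx ?orbT.
Qed.

(** [X] and [Y] define a vertex set [U] of the multigraph. If its edge cut [B] had fewer than
    [3 * m] members, deleting [B] would keep the line graph connected, and every terminal would
    retain an edge. Edges outside [B] that meet lie on the same side of [U], so all terminals would
    be on one side. *)
Lemma high_cut (X : {set terminal}) (Y : {set T + V}) : X != set0 -> X != setT ->
  3 * m <= #|[set d | (dart_terminal d \in X) != (dart_group d \in Y)]|.
Proof.
move=> /set0Pn[s1 s1X] XT.
have [s2 s2X] : exists s2, s2 \notin X.
  apply/existsP; rewrite -negb_forall; apply: contra XT => /forallP h.
  by apply/eqP/setP => s; rewrite inE h.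
pose U := [set u | if insub u is Some s then s \in X else inr u \in Y].
have UX (s : terminal) : (val s \in U) = (s \in X) by rewrite inE valK.
have UY u : ~~ high u -> (u \in U) = (inr u \in Y) by move=> h; rewrite inE insubN.
pose B := [set x | ((ends x).1 \in U) != ((ends x).2 \in U)].
set cut := [set d | _]; rewrite leqNgt; apply/negP => ltc.
(* A cut edge with one high end provides its only dart; if both ends are high, the group [inl x] is
   separated from one of them. *)
have BS : B \subset [set dart_edge d | d in cut].
  have one x b : high (dart_end (x, b)) -> ~~ high (dart_opp (x, b)) ->
      (dart_end (x, b) \in U) != (dart_opp (x, b) \in U) -> x \in [set dart_edge d | d in cut].
    move=> h nh ne; apply/imsetP; exists (exist _ (x, b) h) => //.
    have gE : dart_group (exist _ (x, b) h) = inr (dart_opp (x, b)).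
      by rewrite /dart_group ifN.
    by rewrite inE gE -UX -(UY _ nh).
  apply/subsetP => x; rewrite inE => ne; have hh := high_end x.
  have [h1|h1] := boolP (high (ends x).1); last first.
    rewrite (negPf h1) /= in hh.
    by apply: (one x false) => //; rewrite /dart_opp /dart_end /= eq_sym.
  have [h2|h2] := boolP (high (ends x).2); last by apply: (one x true).
  pose d1 : dart := exist _ (x, true) h1; pose d2 : dart := exist _ (x, false) h2.
  have g1 : dart_group d1 = inl x by rewrite /dart_group /dart_opp /= /dart_end /= h2.
  have g2 : dart_group d2 = inl x by rewrite /dart_group /dart_opp /= /dart_end /= h1.
  have [c1|] := boolP (d1 \in cut); first by apply/imsetP; exists d1.
  have [c2|] := boolP (d2 \in cut); first by move=> _; apply/imsetP; exists d2.
  rewrite !inE g1 g2 -!UX /= /dart_end /= !negbK => /eqP e2 /eqP e1.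
  by rewrite e1 e2 eqxx in ne.
have ltB : #|B| < 3 * m.
  by apply: leq_ltn_trans (subset_leq_card BS) (leq_ltn_trans (leq_imset_card _ _) ltc).
have ltBk : #|B| < k by apply: leq_trans ltB _; move: km m0; lia.
have edge (s : terminal) : exists2 x, inc (val s) x & x \notin B.
  have /subsetPn[x] : ~~ (star ends (val s) \subset B).
    apply/negP => /subset_leq_card le; have := leq_trans (valP s) le.
    by rewrite leqNgt ltB.
  by rewrite inE; exists x.
have side x u : x \notin B -> inc u x ->
    ((ends x).1 \in U) = (u \in U) /\ ((ends x).2 \in U) = (u \in U).
  by rewrite inE negbK => /eqP E /orP[]/eqP<-; split.
have [x1 i1 x1B] := edge s1; have [x2 i2 x2B] := edge s2.
have := kc.2 B ltBk x1 x2; rewrite !in_setC => /(_ x1B x2B) /connectP[s sP x2E].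
suff : val s2 \in U by rewrite UX (negPf s2X).
rewrite -(side _ _ x2B i2).1 x2E.
have : (ends x1).1 \in U by rewrite (side _ _ x1B i1).1 UX.
elim: s x1 x1B {i1 x2E} sP => [|y s IHs] x xB //= /andP[/and3P[xy _ yB] sP] xU.
rewrite in_setC in yB; apply: IHs (yB) sP _.
have /line_adjP[_ [u [ux uy]]] := xy.
by rewrite (side _ _ yB uy).1 -(side _ _ xB ux).1.
Qed.

Lemma dart_eq d d' : dart_edge d = dart_edge d' ->
  d = d' \/ dart_group d = inl (dart_edge d) /\ dart_group d' = inl (dart_edge d).
Proof.
case: d d' => [[x b] h] [[x' b'] h']; rewrite /dart_edge /= => E; rewrite -{x'}E in h' *.
have [bb|bb] := eqVneq b b'.
  by left; apply: val_inj; rewrite /= bb.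
have E : b' = ~~ b by case: b b' bb {h h'} => [] [].
right; rewrite /dart_group /= /dart_opp /=; subst b'.
by rewrite h' negbK h.
Qed.

Lemma dart_group_edge d d' : dart_group d = dart_group d' ->
  dart_edge d = dart_edge d' \/ exists u, inc u (dart_edge d) /\ inc u (dart_edge d').
Proof.
have := dart_opp_incident d; have := dart_opp_incident d'.
rewrite /dart_group; do 2 case: ifP => _ //.
- by move=> _ _ [E]; left; exact: E.
- by move=> i' i [E]; right; exists (dart_opp (val d)); rewrite {2}E.
Qed.

Lemma dart_group_inl d x : dart_group d = inl x -> dart_edge d = x.
Proof. by rewrite /dart_group; case: ifP => // _ []. Qed.

(** * Colours of a packing as disjoint connected sets of the line graph *)

Section Colours.
Variable (A : {set dart * dart * 'I_m}).
Hypotheses (pA : packing dart_group A)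
  (cA : forall l x y, econn (src dart_terminal) (tgt dart_terminal) (col A l) x y).

Definition colour (l : nat) : {set T} :=
  [set x | [exists a in A, (a.2 == l :> nat) && [exists d, uses a d && (dart_edge d == x)]]].

Lemma colourP l x : reflect
  (exists a d, [/\ a \in A, a.2 = l :> nat, uses a d & dart_edge d = x]) (x \in colour l).
Proof.
rewrite inE; apply: (iffP exists_inP) => [[a aA /andP[/eqP al /existsP[d /andP[u /eqP]]]]|].
  by exists a, d.
move=> [a [d [aA al u de]]]; exists a => //; rewrite al eqxx /=.
by apply/existsP; exists d; rewrite u de eqxx.
Qed.

Lemma uses_group a d d' : a \in A -> uses a d -> uses a d' -> dart_group d = dart_group d'.
Proof. by move=> aA; have [_ E] := pA.1 a aA; do 2 case/orP=> /eqP->. Qed.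

(** Items have disjoint darts. An edge with two darts is a group consisting of just these, so an
    item using one of them uses both. *)
Lemma colour_disjoint l l' : l != l' -> [disjoint colour l & colour l'].
Proof.
move=> ll'; rewrite disjoints_subset; apply/subsetP => x /colourP[a [d [aA al ud dx]]].
rewrite in_setC; apply/colourP => -[a' [d' [aA' al' ud' dx']]].
suff aa : a = a' by rewrite -al -al' aa eqxx in ll'.
have [E|ne] := eqVneq d' d; first by apply: pA.2 ud _ => //; rewrite -E.
have [E|[gd gd']] := dart_eq (etrans dx (esym dx')); first by rewrite E eqxx in ne.
have [d2 ud2 d2d] : exists2 d2, uses a d2 & d2 != d.
  have [na _] := pA.1 a aA; case/orP: ud => /eqP->.
    by exists a.1.2; rewrite /uses ?eqxx ?orbT // eq_sym.
  by exists a.1.1; rewrite /uses ?eqxx.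
have d2x : dart_edge d2 = x.
  by apply: dart_group_inl; rewrite (uses_group aA ud2 ud) gd dx.
suff d2d' : d2 = d' by apply: pA.2 ud2 _ => //; rewrite d2d'.
move: d2d ne d2x dx dx'; rewrite /dart_edge.
case: d2 d d' {ud ud2 ud' gd gd'} => [[y b] h] [[y' b'] h'] [[y'' b''] h''] /=.
rewrite -!(inj_eq val_inj) /= => n1 n2 e1 e2 e3; apply: val_inj => /=.
move: n1 n2; rewrite e1 e2 e3 !xpair_eqE eqxx /=.
by case: b {h}; case: b' {h'}; case: b'' {h''}.
Qed.

Lemma terminal_touch (s1 s2 : terminal) l : l < m -> s1 != s2 ->
  exists2 x, x \in colour l & inc (val s1) x.
Proof.
move=> lm ne; have /connectP[[|z s] /=] := cA (Ordinal lm) s1 s2.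
  by move=> _ E; rewrite E eqxx in ne.
case/andP=> /exists_inP[a]; rewrite inE => /andP[aA /eqP al] aE _ _.
have [d ud dE] : exists2 d, uses a d & dart_terminal d = s1.
  case/orP: aE => /andP[/eqP E1 /eqP E2]; [exists a.1.1 | exists a.1.2] => //;
  by rewrite /uses eqxx ?orbT.
exists (dart_edge d); last by rewrite -dE; exact: dart_incident.
by apply/colourP; exists a, d; rewrite al.
Qed.

Hypothesis two : forall s : terminal, exists s', s != s'.

Lemma same_vertex_within (C : {set T}) u x y : x \in C -> y \in C -> inc u x -> inc u y ->
  within adj C x y.
Proof.
move=> xC yC ux uy; have [->|ne] := eqVneq x y; first exact: connect0.
by apply: within_edge => //; apply/line_adjP; split=> //; exists u.
Qed.

Lemma colour_connected l : l < m -> connected_in adj (colour l).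
Proof.
move=> lm; pose C := colour l.
have wS := within_sym (@line_adj_sym V T ends) C.
have wT x y z : within adj C x y -> within adj C y z -> within adj C x z.
  exact: connect_trans.
pose r : rel terminal := fun s s' => [forall x in C, forall y in C,
  inc (val s) x ==> (inc (val s') y ==> within adj C x y)].
have rP s s' : reflect (forall x y, x \in C -> y \in C -> inc (val s) x ->
    inc (val s') y -> within adj C x y) (r s s').
  apply: (iffP forall_inP) => h x.
    by move=> y xC yC ix iy; have /forall_inP/(_ y yC)/implyP/(_ ix)/implyP/(_ iy) := h x xC.
  by move=> xC; apply/forall_inP => y yC; apply/implyP => ix; apply/implyP => iy; exact: h.
have rall s s' : r s s'.
  apply: econn_gen (cA (Ordinal lm) s s') => [{}s|{}s {}s'|{}s' {}s s''|a].
  - by apply/rP => x y xC yC; exact: same_vertex_within.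
  - by apply/rP/rP => h x y xC yC ix iy; rewrite wS; exact: h.
  (* Transitivity needs an edge of this colour at the middle terminal; it exists because [s'] is
     joined to another terminal. *)
  - move=> /rP h1 /rP h2; apply/rP => x y xC yC ix iy; have [s2 ne] := two s'.
    have [z zC iz] := terminal_touch lm ne.
    by apply: wT (h1 _ _ xC zC ix iz) (h2 _ _ zC yC iz iy).
  - rewrite inE => /andP[aA /eqP al]; apply/rP => x y xC yC ix iy.
    have i1 := dart_incident a.1.1; have i2 := dart_incident a.1.2.
    have C1 : dart_edge a.1.1 \in C.
      by apply/colourP; exists a, a.1.1; rewrite /uses eqxx al.
    have C2 : dart_edge a.1.2 \in C.
      by apply/colourP; exists a, a.1.2; rewrite /uses eqxx orbT al.
    apply: (wT _ _ _ (same_vertex_within xC C1 ix i1)).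
    apply: (wT _ (dart_edge a.1.2)) (same_vertex_within C2 yC i2 iy).
    have [_ gE] := pA.1 a aA; have [->|[u [u1 u2]]] := dart_group_edge gE.
      exact: connect0.
    exact: same_vertex_within u1 u2.
move=> x y xC yC.
have term z : z \in C -> exists s : terminal, inc (val s) z.
  by move=> /colourP[a [d [_ _ _ <-]]]; exists (dart_terminal d); exact: dart_incident.
have [s ix] := term x xC; have [s' iy] := term y yC.
exact: (rP _ _ (rall s s')) xC yC ix iy.
Qed.

End Colours.

Lemma terminals_bound D : (forall u, #|star ends u| <= D) -> #|T| <= #|{: terminal}| * D.
Proof.
move=> deg; apply: leq_trans (_ : #|\bigcup_(s : terminal) star ends (val s)| <= _).
  apply: subset_leq_card; apply/subsetP => x _; apply/bigcupP.
  by case/orP: (high_end x) => h; [exists (Sub (ends x).1 h : terminal) |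
    exists (Sub (ends x).2 h : terminal)]; rewrite ?inE // SubK /incident eqxx ?orbT.
apply: leq_trans (card_bigcup_leq _ _) _; rewrite -sum_nat_const.
exact: leq_sum.
Qed.

End HighDegree.

Theorem theorem1p6 :
  forall t r : nat, 1 <= t -> 3 <= r ->
  exists f : nat,
    forall (T : finType) (e : rel T),
      symmetric e -> irreflexive e ->
      is_line_graph e ->
      k_connected e (30 * t - 15) ->
      f <= #|T| ->
      is_minor (line_adj (@Ctr_ends t r)) e.
Proof.
move=> t r t1 r3; have rt0 : 0 < r * t by lia.
(* [2 * (r * t)] bounds the degrees in the line graph once all stars have at most [r * t] edges. *)
have [N NP] := linked_exists (3 * t) r (2 * (r * t)).
(* Every edge has a terminal end, so this size forces [N.+2] terminals: enough for [linked_exists],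
   and at least two. *)
exists (N.+2 * (r * t)) => T e es ei [V [E [ends0 [_ [f [fbij ef]]]]]] kc leT.
pose ends x := ends0 (f x).
have {}ef : e = line_adj ends.
  apply/funext => x; apply/funext => y.
  by rewrite ef /line_adj (inj_eq (bij_inj fbij)).
rewrite {}ef in kc es ei *.
have [/existsP[u le]|/existsPn small] := boolP [exists u, r * t <= #|star ends u|].
  exact: clique_minor le.
have deg u : #|star ends u| <= r * t by apply: ltnW; rewrite ltnNge.
(* With [m = 3t] this reads [18t < 30t - 11]. *)
have km : 6 * (3 * t) < 30 * t - 15 + 4 by lia.
have m0 : 0 < 3 * t by lia.
pose X := {u : V | high ends (3 * t) u}.
have leX : N.+2 <= #|{: X}|.
  by rewrite -(leq_pmul2r rt0) (leq_trans leT (terminals_bound kc km m0 deg)).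
have two (s : X) : exists s', s != s'.
  have /card_gt0P[s'] : 0 < #|predC1 s|.
    by rewrite cardC1; case: #|_| leX => [|[]].
  by rewrite inE eq_sym; exists s'.
have [A [pA cA]] := packing_exists m0 (high_cut kc km m0).
pose F := colour A.
(* [g (l, s)] represents the terminal [s] in colour [l]; for indices that are not colours its value
   is arbitrary. *)
have /choice[g gP] (p : nat * X) : exists x : T, p.1 < 3 * t ->
    x \in F p.1 /\ incident ends (val p.2) x.
  have [lm|_] := ltnP p.1 (3 * t).
    by have [s' ne] := two p.2; have [x xF ix] := terminal_touch cA lm ne; exists x.
  have /card_gt0P[x _] : 0 < #|T| by apply: leq_trans leT; rewrite muln_gt0.
  by exists x.
have F_disj l l' : l != l' -> [disjoint F l & F l'] by exact: colour_disjoint.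
have [||||||xs [_ lnk]] := NP T (line_adj ends) X F (fun l s => g (l, s)).
- exact: line_adj_sym.
- by move=> z; exact: line_degree.
- by move=> l; exact: colour_connected.
- by move=> l s lm; exact: (gP (l, s) lm).1.
(* A representative is incident with its terminal, so one edge represents at most its two ends. *)
- move=> l x lm; rewrite -(card_imset _ val_inj).
  apply: leq_trans (_ : #|[set (ends x).1; (ends x).2]| <= _); last first.
    by rewrite cards2; case: eqP.
  apply: subset_leq_card; apply/subsetP => u /imsetP[s]; rewrite inE => /eqP gE ->.
  have := (gP (l, s) lm).2; rewrite gE /incident /= => /orP[]/eqP<-; rewrite !inE eqxx //.
  by rewrite orbT.
- exact: ltnW (ltnW leX).
apply: (ring_minor (F := F) (f := fun l s => g (l, s)) (xs := xs)) => [l l' _ _|l l' s lm lm' ll'|//].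
  exact: F_disj.
have [xF ix] := gP (l, s) lm; have [yF iy] := gP (l', s) lm'.
apply/line_adjP; split; last by exists (val s).
by apply: contraTneq yF => <-; rewrite (disjointFr (F_disj _ _ ll') xF).
Qed.
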